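(* Let $n,k$ be integers with $1\le k<n$, and let $K$ and $L$ be origin-symmetric star bodies in $\mathbb{R}^n$ such that $L\subset K$. Then $$|K|^{\frac{n-k}{n}}-|L|^{\frac{n-k}{n}}\le c_{n,k}^k\, d_{\rm ovr}^k(K,\mathcal{BP}_k^n)\,\max_{F\in {\rm Gr}_{n-k}}\big(|K\cap F|-|L\cap F|\big).$$
   Context: $|\cdot|$ denotes volume (Lebesgue measure) of the appropriate dimension, ${\rm Gr}_{n-k}$ is the Grassmannian of $(n-k)$-dimensional linear subspaces of $\mathbb{R}^n$, and $\omega_m$ is the volume of the unit Euclidean ball in $\mathbb{R}^m$. The constant $c_{n,k}$ is the positive number defined by $c_{n,k}^k=\omega_n^{\frac{n-k}{n}}/\omega_{n-k}$. A closed bounded set $K\subset\mathbb{R}^n$ is a star body if every straight line through the origin crosses the boundary of $K$ at exactly two points different from the origin, the origin is an interior point of $K$, and the Minkowski functional $\|x\|_K=\min\{a\ge 0: x\in aK\}$ is continuous on $\mathbb{R}^n$. Its radial function is $\rho_K(x)=\|x\|_K^{-1}$, $x\ne 0$. Origin-symmetric means $K=-K$. The $(n-k)$-dimensional spherical Radon transform $R_{n-k}:C(S^{n-1})\to C({\rm Gr}_{n-k})$ is $R_{n-k}g(E)=\int_{S^{n-1}\cap E}g(\theta)\,d\theta$, where $d\theta$ is the (non-normalized) Lebesgue measure on the sphere $S^{n-1}\cap E$ (counting measure if $\dim E=1$). An origin-symmetric star body $D$ in $\mathbb{R}^n$ is a generalized $k$-intersection body, written $D\in\mathcal{BP}_k^n$,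 if there exists a finite non-negative Borel measure $\mu_D$ on ${\rm Gr}_{n-k}$ such that for every $g\in C(S^{n-1})$, $\int_{S^{n-1}}\rho_D^k(\theta)g(\theta)\,d\theta=\int_{{\rm Gr}_{n-k}}R_{n-k}g(H)\,d\mu_D(H)$. The outer volume ratio distance is $d_{\rm ovr}(K,\mathcal{BP}_k^n)=\inf\{(|D|/|K|)^{1/n}: K\subset D,\ D\in\mathcal{BP}_k^n\}$, and $d_{\rm ovr}^k$ denotes its $k$-th power. *)

(* Defs.v *)
From HB Require Import structures.
From mathcomp Require Import all_boot all_order all_algebra.
From mathcomp Require Import all_classical all_reals all_analysis.
From mathcomp Require Import measurable_realfun.

Set Implicit Arguments.
Unset Strict Implicit.
Unset Printing Implicit Defensive.

Import Order.TTheory GRing.Theory Num.Theory.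
Import numFieldNormedType.Exports.

Local Open Scope classical_set_scope.
Local Open Scope ring_scope.

(* 'rV[R]_n carries the product sigma-algebra of the Borel sets of R, as
   n.-tuple does in the library; it is the Borel sigma-algebra of 'rV[R]_n. *)
Definition measure_row_display : measure_display.
Proof. exact: default_measure_display. Qed.

Section measurable_row.
Variables (R : realType) (n : nat).

Let coord : 'I_n -> 'rV[R]_n -> measurableTypeR R := fun i x => x ord0 i.

Let row_set0 : g_sigma_preimage coord set0.
Proof. exact: sigma_algebra0. Qed.

Let row_setC A : g_sigma_preimage coord A -> g_sigma_preimage coord (~` A).
Proof. exact: sigma_algebraC. Qed.

Let row_bigcup (F : _^nat) : (forall i, g_sigma_preimage coord (F i)) ->
  g_sigma_preimage coord (\bigcup_i (F i)).
Proof. exact: sigma_algebra_bigcup. Qed.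

HB.instance Definition _ := @isMeasurable.Build measure_row_display
  'rV[R]_n (g_sigma_preimage coord) row_set0 row_setC row_bigcup.

Lemma measurable_coord (i : 'I_n) :
  measurable_fun [set: 'rV[R]_n] (fun x => x ord0 i : measurableTypeR R).
Proof.
move=> _ Y mY; rewrite setTI; apply: sub_sigma_algebra => /=.
rewrite -bigcup_seq/=; exists i => /=; first by rewrite mem_index_enum.
by exists Y => //; rewrite setTI.
Qed.

Lemma measurable_fun_row d (T : measurableType d) (f : T -> 'rV[R]_n) :
  (forall i, measurable_fun [set: T] (fun t => f t ord0 i : measurableTypeR R)) ->
  measurable_fun [set: T] f.
Proof.
move=> mf _ A mA; rewrite setTI.
pose G := [set B : set 'rV[R]_n | measurable (f @^-1` B)].
suff : measurable `<=` G by apply.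
apply: smallest_sub => /=.
  split; rewrite /G /=.
  - by rewrite preimage_set0.
  - by move=> B mB; rewrite setTD -preimage_setC; exact: measurableC.
  - by move=> F mF; rewrite preimage_bigcup; exact: bigcup_measurable.
rewrite -bigcup_seq; apply: bigcup_sub => i _ _ [B mB <-] /=.
rewrite /G /= setTI.
by have := mf i measurableT B mB; rewrite setTI.
Qed.

End measurable_row.

(* The library's pushforward, with the measurability proof as an argument. *)
Definition image_measure d d' (T1 : measurableType d) (T2 : measurableType d')
    (R : realFieldType) (m : {measure set T1 -> \bar R}) (f : T1 -> T2)
    (mf : measurable_fun [set: T1] f) : {measure set T2 -> \bar R} :=
  measure_function_pushforward__canonical__measure_function_Measure m mf.

Section lebesgue_row.
Variable R : realType.

Definition row_cons n (p : 'rV[R]_n * measurableTypeR R) : 'rV[R]_n.+1 :=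
  row_mx (p.2%:M : 'M[R]_1) p.1 : 'rV[R]_(1 + n).

Lemma measurable_row_cons n : measurable_fun setT (@row_cons n).
Proof.
apply: measurable_fun_row => i.
have -> : (fun p : 'rV[R]_n * measurableTypeR R =>
    row_cons p ord0 i : measurableTypeR R) =
  if unlift ord0 i is Some j then (fun p => p.1 ord0 j) else snd.
  apply/funext => p; rewrite /row_cons.
  case: unliftP => [j|] -> /=.
    rewrite -[RHS](row_mxEr (p.2%:M : 'M[R]_1)); congr (row_mx _ _ _ _).
    exact/val_inj.
  rewrite -[RHS](_ : (p.2%:M : 'M[R]_1) ord0 ord0 = _); last first.
    by rewrite mxE eqxx.
  rewrite -[RHS](row_mxEl _ p.1); congr (row_mx _ _ _ _); exact/val_inj.
case: unliftP => [j|] _; last exact: measurable_snd.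
exact: measurableT_comp (measurable_coord j) measurable_fst.
Qed.

Fixpoint lebesgue_row n : {measure set 'rV[R]_n -> \bar R} :=
  if n is m.+1 then
    image_measure (lebesgue_row m \x @lebesgue_measure R)%E (@measurable_row_cons m)
  else \d_(0 : 'rV[R]_0).

End lebesgue_row.

Section euclidean.
Variables (R : realType) (n : nat).
Implicit Types (x : 'rV[R]_n) (A : set 'rV[R]_n).

(* The library's norm on 'rV[R]_n is the sup norm. *)
Definition enorm x : R := Num.sqrt (\sum_i x ord0 i ^+ 2).

Definition sphere : set 'rV[R]_n := [set x | enorm x = 1].

Definition unit_ball : set 'rV[R]_n := [set x | enorm x <= 1].

Definition vol A : R := fine (lebesgue_row R n A).

Definition normalize x : 'rV[R]_n := (enorm x)^-1 *: x.

Lemma measurable_enorm :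
  measurable_fun setT (enorm : 'rV[R]_n -> measurableTypeR R).
Proof.
pose s x : measurableTypeR R := \sum_i x ord0 i ^+ 2.
have -> : enorm = (fun r : measurableTypeR R => r `^ 2^-1) \o s.
  by apply/funext => x /=; rewrite powR12_sqrt// sumr_ge0// => i _; rewrite sqr_ge0.
apply: measurableT_comp; first exact: measurable_powR.
apply: measurable_sum => i; apply: (measurable_funX 2); exact: measurable_coord.
Qed.

Lemma measurable_normalize : measurable_fun setT normalize.
Proof.
apply: measurable_fun_row => i; rewrite /normalize.
under eq_fun do rewrite mxE -powR_inv1 ?sqrtr_ge0//.
apply: measurable_funM; last exact: measurable_coord.
exact: (measurableT_comp (measurable_powR (-1)) measurable_enorm).
Qed.

Lemma measurable_pball : measurable [set x : 'rV[R]_n | 0 < enorm x <= 1].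
Proof.
have := measurable_enorm measurableT (measurable_itv `]0 : R, 1]).
by rewrite setTI.
Qed.

(* Surface measure on the unit sphere of a d-dimensional space with Lebesgue
   measure mu, via polar coordinates: A has measure
   d * mu {r *: theta | 0 < r <= 1, theta in A}.  For d = 1 this is the
   counting measure of the two unit vectors. *)
Definition surface (d : nat) (mu : {measure set 'rV[R]_n -> \bar R}) :
    {measure set 'rV[R]_n -> \bar R} :=
  mscale d%:R%:nng (image_measure (mrestr mu measurable_pball)
                                  measurable_normalize).

End euclidean.
Arguments sphere : clear implicits.
Arguments unit_ball : clear implicits.

Section grassmannian.
Variables (R : realType) (n k : nat).

(* Gr_{n-k}; indexing by the codimension makes the type inhabited for all n, k. *)
Definition grassmannian := {H : {vspace 'rV[R]_n} | \dim H == (n - k)%N}.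

Definition carrier (H : grassmannian) : set 'rV[R]_n := [set` val H].

Lemma grassmannian_inhabited : exists H : grassmannian, True.
Proof.
have [X /andP[/eqP sX fX]] : exists X : seq 'rV[R]_n, (size X == n - k)%N && free X.
  exists (take (n - k) (vbasis {:'rV[R]_n})).
  rewrite size_takel ?size_tuple ?eqxx ?dimvf /dim/= ?mul1n ?leq_subr//=.
  have := basis_free (vbasisP {:'rV[R]_n}).
  by rewrite -[X in free X](cat_take_drop (n - k)); exact: catl_free.
have dX : \dim <<X>> == (n - k)%N by rewrite (eqP fX) sX.
by exists (exist _ <<X>>%VS dX).
Qed.

HB.instance Definition _ := Choice.on grassmannian.
HB.instance Definition _ := isPointed.Build grassmannian
  (projT1 (cid grassmannian_inhabited)).

(* Matrices whose rows are orthonormal. *)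
Definition stiefel : set 'M[R]_(n - k, n) := [set B | B *m B^T = 1%:M].

Definition row_span (B : 'M[R]_(n - k, n)) : {vspace 'rV[R]_n} :=
  <<[seq row i B | i : 'I_(n - k)]>>%VS.

(* The quotient topology of the map row_span from orthonormal frames. *)
Definition gr_open (U : set grassmannian) : Prop :=
  open ([set B | exists2 H, U H & row_span B = val H] : set (subspace stiefel)).

Lemma dim_row_span B : stiefel B -> \dim (row_span B) = (n - k)%N.
Proof.
move=> BB; pose X := [tuple row i B | i < n - k].
have XE : row_span B = <<X>>%VS by [].
suff : free X by rewrite XE => /eqP ->; rewrite size_tuple.
apply/freeP => c c0 i.
have /rowP/(_ i) : (\row_j c j) *m B *m B^T = 0.
  rewrite (_ : _ *m B = 0) ?mul0mx// mulmx_sum_row -[RHS]c0.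
  by apply: eq_bigr => j _; rewrite mxE (nth_map i) ?size_enum_ord// nth_ord_enum.
by rewrite -mulmxA BB mulmx1 !mxE.
Qed.

Lemma gr_openT : gr_open setT.
Proof.
rewrite /gr_open -open_subspaceIT.
rewrite (_ : _ `&` _ = stiefel); first exact: open_subspaceT.
apply/seteqP; split => B /= => [[]//|SB]; split => //.
exists (exist _ (row_span B) (introT eqP (dim_row_span SB))) => //.
Qed.

Lemma gr_openI : setI_closed gr_open.
Proof.
move=> U V oU oV; rewrite /gr_open.
rewrite [X in open X](_ : _ = [set B | exists2 H, U H & row_span B = val H]
  `&` [set B | exists2 H, V H & row_span B = val H]); first exact: openI.
apply/seteqP; split => B /=.
  by move=> [H [UH VH] BH]; split; exists H.
move=> [[H UH BH] [H' VH' BH']]; exists H => //; split => //.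
by rewrite (_ : H = H')//; apply: val_inj; exact: etrans (esym BH) BH'.
Qed.

Lemma gr_open_bigU (I : Type) (f : I -> set grassmannian) :
  (forall i, gr_open (f i)) -> gr_open (\bigcup_i f i).
Proof.
move=> fo; rewrite /gr_open.
rewrite [X in open X](_ : _ =
    \bigcup_i [set B | exists2 H, f i H & row_span B = val H]).
  by apply: bigcup_open => i _; exact: fo.
apply/seteqP; split => B /=.
  by move=> [H [i _ fiH] BH]; exists i => //; exists H.
by move=> [i _ [H fiH BH]]; exists H => //; exists i.
Qed.

HB.instance Definition _ := isOpenTopological.Build grassmannian
  gr_openT gr_openI gr_open_bigU.

(* An orthonormal basis of H; rotation invariance of Lebesgue measure makes the
   measures below independent of this choice. *)
Definition frame (H : grassmannian) : 'M[R]_(n - k, n) :=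
  xget 0 [set B | stiefel B /\ row_span B = val H].

Lemma measurable_mulmxr (B : 'M[R]_(n - k, n)) :
  measurable_fun setT (fun y : 'rV[R]_(n - k) => y *m B).
Proof.
apply: measurable_fun_row => i; under eq_fun do rewrite mxE.
apply: measurable_sum => j; apply: measurable_funM => //.
exact: measurable_coord.
Qed.

(* (n - k)-dimensional Lebesgue measure on H, as a measure on R^n *)
Definition subspace_lebesgue (H : grassmannian) :
    {measure set 'rV[R]_n -> \bar R} :=
  image_measure (lebesgue_row R (n - k)) (measurable_mulmxr (frame H)).

Definition subspace_vol (H : grassmannian) (A : set 'rV[R]_n) : R :=
  fine (subspace_lebesgue H A).

Definition radon (g : 'rV[R]_n -> R) (H : grassmannian) : R :=
  \int[surface (n - k) (subspace_lebesgue H)]_(x in sphere R n `&` carrier H) g x.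

End grassmannian.

Section star_bodies.
Variables (R : realType) (n : nat).
Implicit Types K D : set 'rV[R]_n.

(* For star bodies the infimum is attained. *)
Definition minkowski K (x : 'rV[R]_n) : R :=
  inf [set a | 0 <= a /\ exists2 y, K y & x = a *: y].

Definition star_body K : Prop :=
  [/\ closed K, bounded_set K,
      (forall u : 'rV[R]_n, u != 0 -> exists p q, p != q /\
        range (fun t : R => t *: u) `&` (closure K `\` K°) `\ 0 = [set p; q]),
      K° 0 & continuous (minkowski K)].

Definition origin_symmetric K : Prop := -%R @` K = K.

Definition radial K (x : 'rV[R]_n) : R := (minkowski K x)^-1.

Definition generalized_intersection_body (k : nat) D : Prop :=
  [/\ star_body D, origin_symmetric D &
    exists mu : {finite_measure
        set (g_sigma_algebraType (@open (grassmannian R n k))) -> \bar R},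
      forall g : 'rV[R]_n -> R, {within sphere R n, continuous g} ->
        \int[surface n (lebesgue_row R n)]_(x in sphere R n)
            (radial D x ^+ k * g x)
        = \int[mu]_H radon g H].

Definition ovr_distance (k : nat) K : \bar R :=
  ereal_inf [set ((vol D / vol K) `^ n%:R^-1)%:E |
    D in [set D | K `<=` D /\ generalized_intersection_body k D]].

End star_bodies.

Section constants.
Variables (R : realType).

Definition omega (m : nat) : R := vol (unit_ball R m).

Definition c_const (n k : nat) : R :=
  (omega n `^ ((n - k)%:R / n%:R) / omega (n - k)) `^ k%:R^-1.

End constants.

(* Main.v *)
Require Import Defs.
From HB Require Import structures.
From mathcomp Require Import all_boot all_order all_algebra.
From mathcomp Require Import all_classical all_reals all_analysis.
From mathcomp Require Import measurable_realfun ring.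

Set Implicit Arguments.
Unset Strict Implicit.
Unset Printing Implicit Defensive.

Import Order.TTheory GRing.Theory Num.Theory.
Import numFieldNormedType.Exports.

Local Open Scope classical_set_scope.
Local Open Scope ring_scope.

(** Let d = n - k, let rho_K be the radial function of K, S the unit sphere, and M the
    maximum of |K \cap F| - |L \cap F|.  In polar coordinates n |K| is the integral of
    rho_K^n over S, and d |K \cap F| is the integral of rho_K^d over the unit sphere of F,
    that is, the Radon transform of rho_K^d at F ([gauge_surface_integral]).  So the
    Radon transform of rho_K^d - rho_L^d is at most d M everywhere.

    Let D contain K and be a generalized k-intersection body with measure mu of total mass
    m.  Its defining identity, for the function rho_K^d - rho_L^d, gives

      \int_S rho_D^k (rho_K^d - rho_L^d) <= d M m.

    As rho_D >= rho_K >= rho_L, the left-hand side is at least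
    \int_S rho_K^n - \int_S rho_K^k rho_L^d, and by the dual Minkowski inequality
    ([dual_mixed_volume_le]) this is at least n |K| - n |K|^(k/n) |L|^(d/n).  The same
    identity for the constant 1 gives, with the dual Minkowski inequality for D and the
    unit ball,

      d omega_d m = \int_S rho_D^k <= n |D|^(k/n) omega_n^(d/n).

    Eliminating m yields

      |K|^(d/n) - |L|^(d/n) <= c_{n,k}^k (|D| / |K|)^(k/n) M

    ([intersection_body_gap_bound]), and the theorem follows by taking the infimum over D.

    Two points remain.  The maximum is attained ([section_gap_max]) because the volume of a
    section is a continuous function of an orthonormal frame, the frames form a compact
    set, and frames with the same span give the same volume; the last fact is the rotation
    invariance of Lebesgue measure, which is deduced from the uniqueness of
    translation-invariant measures ([lebesgue_row_orthogonal]).  And the infimum may be over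
    the empty set, in which case the distance is infinite: then the right-hand side is
    infinite unless M = 0, and M = 0 only if K = L ([strict_section_gap]). *)

(** * Lebesgue measure of cubes *)

Section lebesgue_row_basics.
Variable R : realType.
Local Open Scope ereal_scope.

Definition cube n (r : R) : set 'rV[R]_n := [set x | forall i, `|x ord0 i|%R <= r]%R.
Arguments cube : clear implicits.

Lemma measurable_cube n r : measurable (cube n r).
Proof.
have -> : cube n r = \bigcap_(i : 'I_n)
    ((fun x => x ord0 i : measurableTypeR R) @^-1` `[(- r)%R, r]).
  apply/seteqP; split => x /= H i; first by move=> _; rewrite /= in_itv/= -ler_norml.
  by have := H i I; rewrite /= in_itv/= -ler_norml.
apply: fin_bigcap_measurable => [|i _]; first exact: finite_finset.
have := @measurable_coord R n i measurableT _ (measurable_itv `[(- r)%R, r]).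
by rewrite setTI.
Qed.

Lemma lebesgue_rowSE n (A : set 'rV[R]_n.+1) :
  lebesgue_row R n.+1 A =
  (lebesgue_row R n \x @lebesgue_measure R) (@row_cons R n @^-1` A).
Proof. by []. Qed.

Lemma row_cons0 n (p : 'rV[R]_n * measurableTypeR R) : row_cons p ord0 ord0 = p.2.
Proof.
rewrite /row_cons -[RHS](_ : (p.2%:M : 'M[R]_1) ord0 ord0 = _); last first.
  by rewrite mxE eqxx.
rewrite -[RHS](row_mxEl _ p.1); congr (row_mx _ _ _ _); exact/val_inj.
Qed.

Lemma row_consS n (p : 'rV[R]_n * measurableTypeR R) i :
  row_cons p ord0 (lift ord0 i) = p.1 ord0 i.
Proof.
rewrite /row_cons -[RHS](row_mxEr (p.2%:M : 'M[R]_1)); congr (row_mx _ _ _ _).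
exact/val_inj.
Qed.

Lemma lebesgue_row_cube n r : (0 <= r)%R ->
  lebesgue_row R n (cube n r) = ((2 * r) ^+ n)%:E.
Proof.
move=> r0; elim: n => [|n IH].
  rewrite /= diracE expr0 mem_set//; by case.
rewrite lebesgue_rowSE.
have -> : @row_cons R n @^-1` cube n.+1 r = cube n r `*` `[(- r)%R, r].
  apply/seteqP; split => [p /= H|p /= [H1 H2] i].
    split; first by move=> i; have := H (lift ord0 i); rewrite row_consS.
    by have := H ord0; rewrite row_cons0 ler_norml in_itv.
  case: (unliftP ord0 i) => [j|] ->; first by rewrite row_consS.
  by rewrite row_cons0 ler_norml; move: H2; rewrite in_itv.
rewrite product_measure1E//; last exact: measurable_cube.
rewrite IH [X in _ * X](_ : _ = @lebesgue_measure R `[(- r)%R, r])//.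
rewrite lebesgue_measure_itv/= lte_fin.
case: ifPn => [_|]; first by rewrite -EFinD -EFinM opprK exprSr mulr2n mulrDl mul1r.
rewrite -leNgt => H; have -> : (r = 0)%R.
  by apply/eqP; rewrite eq_le r0 andbT -oppr_ge0 (le_trans r0).
by rewrite mule0 mulr0 expr0n.
Qed.

Lemma bigcup_cube n : \bigcup_i cube n i%:R = [set: 'rV[R]_n].
Proof.
rewrite -subTset => x _; exists (Num.truncn (\sum_i `|x ord0 i|)).+1 => // i.
rewrite (le_trans _ (ltW (truncnS_gt _)))//.
by rewrite (bigD1 i)//= lerDl sumr_ge0.
Qed.

Lemma sigma_finite_lebesgue_row n : sigma_finite setT (lebesgue_row R n).
Proof.
exists (fun i => cube n i%:R); first by rewrite bigcup_cube.
move=> i; split; first exact: measurable_cube.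
by rewrite lebesgue_row_cube// ltry.
Qed.

(** A head constant for the function underlying [lebesgue_row], to which the
    sigma-finiteness needed by the Fubini theorems can be attached. *)
Definition lebesgue_rowf n : set 'rV[R]_n -> \bar R := lebesgue_row R n.

HB.instance Definition _ n := Measure.copy (@lebesgue_rowf n) (lebesgue_row R n).

HB.instance Definition _ n := @Measure_isSigmaFinite.Build _ _ _
  (@lebesgue_rowf n) (@sigma_finite_lebesgue_row n).

End lebesgue_row_basics.
Arguments cube : clear implicits.

(** * Translations and dilations of Lebesgue measure *)

Section product_quasi_invariance.
Context d1 d2 (T1 : measurableType d1) (T2 : measurableType d2) (R : realType).
Variables (m1 : {sigma_finite_measure set T1 -> \bar R})
  (m2 : {sigma_finite_measure set T2 -> \bar R}).
Local Open Scope ereal_scope.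

(** A product map rescales the measure of every rectangle by c1 * c2, and measures
    of rectangles determine a sigma-finite product measure. *)
Lemma product_quasi_invariant (f1 : T1 -> T1) (f2 : T2 -> T2) (c1 c2 : {nonneg R}) :
    measurable_fun setT f1 -> measurable_fun setT f2 ->
    (forall A, measurable A -> m1 A = c1%:num%:E * m1 (f1 @^-1` A)) ->
    (forall A, measurable A -> m2 A = c2%:num%:E * m2 (f2 @^-1` A)) ->
  forall A, measurable A -> (m1 \x m2) A = (c1%:num * c2%:num)%:E *
    (m1 \x m2) ((fun p => (f1 p.1, f2 p.2)) @^-1` A).
Proof.
move=> mf1 mf2 h1 h2 A mA.
have mf : measurable_fun setT (fun p : T1 * T2 => (f1 p.1, f2 p.2)).
  by apply: measurable_fun_pair; apply: measurableT_comp.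
have cc0 : (0 <= c1%:num * c2%:num)%R by [].
pose m' : {measure set (T1 * T2) -> \bar R} := mscale (NngNum cc0) (image_measure (m1 \x m2) mf).
suff H : forall X, measurable X -> (m1 \x m2) X = m' X by rewrite H.
apply: product_measure_unique => A1 A2 mA1 mA2.
transitivity ((c1%:num * c2%:num)%:E * (m1 \x m2) ((f1 @^-1` A1) `*` (f2 @^-1` A2))) => //.
rewrite product_measure1E.
- by rewrite (h1 A1)// (h2 A2)// EFinM muleACA.
- by rewrite -[X in measurable X]setTI; exact: mf1.
- by rewrite -[X in measurable X]setTI; exact: mf2.
Qed.

End product_quasi_invariance.

Section lebesgue_row_invariance.
Variable R : realType.
Local Open Scope ereal_scope.

Lemma lebesgue_measure_translate (a : R) (A : set (measurableTypeR R)) : measurable A ->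
  lebesgue_measure A = lebesgue_measure ((fun x : measurableTypeR R => x + a)%R @^-1` A).
Proof.
have mf : measurable_fun setT (fun x : measurableTypeR R => (x + a)%R : measurableTypeR R).
  exact: measurable_funD.
apply: (lebesgue_measure_unique (mu := image_measure lebesgue_measure mf)) => X [[u v]/= _ <-].
rewrite /pushforward (_ : _ @^-1` _ = `](u - a)%R, (v - a)%R]%classic); last first.
  by apply/seteqP; split => x /=; rewrite !in_itv/= ltrBlDr lerBrDr.
rewrite !lebesgue_measure_itv/= !lte_fin ltrD2r.
by case: ifP => // _; rewrite -!EFinD; congr EFin; rewrite opprB addrA subrK.
Qed.

Lemma lebesgue_measure_scale (t : R) (A : set (measurableTypeR R)) : (0 < t)%R ->
  measurable A ->
  lebesgue_measure A = t%:E * lebesgue_measure ((fun x : measurableTypeR R => t * x)%R @^-1` A).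
Proof.
move=> t0.
have mf : measurable_fun setT (fun x : measurableTypeR R => (t * x)%R : measurableTypeR R).
  exact: measurable_funM.
pose t' := NngNum (ltW t0).
apply: (lebesgue_measure_unique
  (mu := mscale t' (image_measure lebesgue_measure mf))) => X [[u v]/= _ <-].
transitivity (t%:E * lebesgue_measure ((fun x : measurableTypeR R => t * x)%R @^-1` `]u, v])) => //.
rewrite (_ : _ @^-1` _ = `](u / t)%R, (v / t)%R]%classic); last first.
  by apply/seteqP; split => x /=; rewrite !in_itv/= ltr_pdivrMr// ler_pdivlMr// (mulrC t).
rewrite !lebesgue_measure_itv/= !lte_fin ltr_pM2r ?invr_gt0//.
case: ifP => [_|]; last by rewrite mule0.
by rewrite -!EFinD -EFinM; congr EFin; rewrite -mulrBl mulrCA divff ?gt_eqF// mulr1.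
Qed.

Lemma measurable_fun_translate n (a : 'rV[R]_n) :
  measurable_fun setT (fun x : 'rV[R]_n => x + a)%R.
Proof.
apply: measurable_fun_row => i; under eq_fun do rewrite mxE.
by apply: measurable_funD => //; exact: measurable_coord.
Qed.

Lemma measurable_fun_scale n (t : R) :
  measurable_fun setT (fun x : 'rV[R]_n => t *: x)%R.
Proof.
apply: measurable_fun_row => i; under eq_fun do rewrite mxE.
by apply: measurable_funM => //; exact: measurable_coord.
Qed.

Lemma row_cons_inj n (p : 'rV[R]_n * measurableTypeR R) (x : 'rV[R]_n.+1) :
  p.2 = x ord0 ord0 -> p.1 = (\row_i x ord0 (lift ord0 i))%R -> row_cons p = x.
Proof.
move=> p2 p1; apply/rowP => i; case: (unliftP ord0 i) => [j|] ->.
  by rewrite row_consS p1 mxE.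
by rewrite row_cons0.
Qed.

(** Induction on the dimension: a translation of R^(n+1) is a product of a
    translation of R^n and one of R. *)
Lemma lebesgue_row_translate n (a : 'rV[R]_n) A : measurable A ->
  lebesgue_row R n A = lebesgue_row R n ((fun x => x + a)%R @^-1` A).
Proof.
elim: n => [|n IH] in a A *.
  move=> mA /=; rewrite diracE diracE; congr ((_ \in _)%:R%:E).
  by apply/seteqP; split => x /=; rewrite (thinmx0 a) addr0.
move=> mA; have mrA : measurable (@row_cons R n @^-1` A).
  by rewrite -[X in measurable X]setTI; exact: measurable_row_cons.
rewrite !lebesgue_rowSE.
apply: (etrans (@product_quasi_invariant _ _ _ _ R (@lebesgue_rowf R n) (@lebesgue_measure R)
   (fun x => x + \row_i a ord0 (lift ord0 i))%R (fun x => x + a ord0 ord0)%R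
   1%:nng%R 1%:nng%R _ _ _ _ _ mrA)).
- exact: measurable_fun_translate.
- exact: measurable_funD.
- by move=> B mB; rewrite mul1e; exact: IH.
- by move=> B mB; rewrite mul1e; exact: lebesgue_measure_translate.
rewrite /= mulr1 mul1e; congr (product_measure1 _ _).
apply/seteqP; split => p /=; suff -> : row_cons
    ((p.1 + \row_i a ord0 (lift ord0 i))%R,
     (p.2 + a ord0 ord0)%R : measurableTypeR R) = (row_cons p + a)%R by [];
  (apply: row_cons_inj => /=; first by rewrite [RHS]mxE row_cons0);
  by apply/rowP => i; rewrite [RHS]mxE [RHS]mxE row_consS ?mxE.
Qed.

(** The same induction as for translations, each coordinate contributing a factor t. *)
Lemma lebesgue_row_scale n (t : R) A : (0 < t)%R -> measurable A ->
  lebesgue_row R n A = (t ^+ n)%:E * lebesgue_row R n ((fun x => t *: x)%R @^-1` A).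
Proof.
move=> t0; elim: n => [|n IH] in A *.
  move=> mA /=; rewrite !diracE expr0 mul1e; congr ((_ \in _)%:R%:E).
  by apply/seteqP; split => x /=; rewrite (thinmx0 x) scaler0.
move=> mA; have mrA : measurable (@row_cons R n @^-1` A).
  by rewrite -[X in measurable X]setTI; exact: measurable_row_cons.
rewrite !lebesgue_rowSE.
apply: (etrans (@product_quasi_invariant _ _ _ _ R (@lebesgue_rowf R n) (@lebesgue_measure R)
   (fun x => t *: x)%R (fun x => t * x)%R
   (NngNum (exprn_ge0 n (ltW t0))) (NngNum (ltW t0)) _ _ _ _ _ mrA)).
- exact: measurable_fun_scale.
- exact: measurable_funM.
- exact: IH.
- by move=> B mB; exact: lebesgue_measure_scale.
rewrite /= exprSr; congr (_ * product_measure1 _ _ _).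
apply/seteqP; split => p /=; suff -> : row_cons
    ((t *: p.1)%R, (t * p.2)%R : measurableTypeR R) = (t *: row_cons p)%R by [];
  (apply: row_cons_inj => /=; first by rewrite [RHS]mxE row_cons0);
  by apply/rowP => i; rewrite [RHS]mxE [RHS]mxE row_consS mxE.
Qed.

End lebesgue_row_invariance.

(** * Uniqueness of translation-invariant measures *)

Section haar.
Context (R : realType) (n : nat).
Variables (lam nu : {sigma_finite_measure set 'rV[R]_n -> \bar R}).
Local Open Scope ereal_scope.

(** Two translation-invariant measures are proportional.  Compute the mass that the
    product measure gives to {(x, y) | x + y in A, y in B}: integrating in x first
    gives lam A * nu B.  For fixed x the substitution y -> y - x turns this set into
    {(x, y) | y in A, y - x in B}, and integrating that in x first gives
    nu A * lam (- B). *)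
Lemma translation_invariant_unique (A B : set 'rV[R]_n) :
    (forall a C, measurable C -> lam C = lam ((fun x => x + a)%R @^-1` C)) ->
    (forall a C, measurable C -> nu C = nu ((fun x => x + a)%R @^-1` C)) ->
    (forall x, B x -> B (- x)%R) -> measurable A -> measurable B ->
  lam A * nu B = nu A * lam B.
Proof.
move=> lamT nuT symB mA mB.
have mfst i : measurable_fun setT (fun p : 'rV[R]_n * 'rV[R]_n => p.1 ord0 i : measurableTypeR R).
  exact: measurableT_comp (@measurable_coord R n i) measurable_fst.
have msnd i : measurable_fun setT (fun p : 'rV[R]_n * 'rV[R]_n => p.2 ord0 i : measurableTypeR R).
  exact: measurableT_comp (@measurable_coord R n i) measurable_snd.
have madd : measurable_fun setT (fun p : 'rV[R]_n * 'rV[R]_n => p.1 + p.2)%R.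
  apply: measurable_fun_row => i; under eq_fun do rewrite mxE.
  exact: (measurable_funD (mfst i) (msnd i)).
have msub : measurable_fun setT (fun p : 'rV[R]_n * 'rV[R]_n => p.2 - p.1)%R.
  apply: measurable_fun_row => i; under eq_fun do rewrite !mxE.
  exact: (measurable_funB (msnd i) (mfst i)).
(* E2 arises from E1 by the shear (x, y) -> (x, y + x). *)
pose E1 := [set p : 'rV[R]_n * 'rV[R]_n | A (p.1 + p.2)%R] `&` snd @^-1` B.
pose E2 := snd @^-1` A `&` [set p : 'rV[R]_n * 'rV[R]_n | B (p.2 - p.1)%R].
have mE1 : measurable E1.
  apply: measurableI; first by rewrite -[X in measurable X]setTI; exact: madd.
  by rewrite -[X in measurable X]setTI; exact: measurable_snd.
have mE2 : measurable E2.
  apply: measurableI; last by rewrite -[X in measurable X]setTI; exact: msub.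
  by rewrite -[X in measurable X]setTI; exact: measurable_snd.
have sw E : measurable E -> (lam \x nu) E = \int[nu]_y lam (ysection E y).
  move=> mE; apply: (product_measure_unique (m' := lam \x^ nu)) => // ? ? ? ?.
  exact: product_measure2E.
transitivity ((lam \x nu) E1).
  rewrite sw// (eq_integral (fun y => lam A * (\1_B y)%:E)); last first.
    move=> y _; rewrite indicE; have [yB|yB] := boolP (y \in B).
      rewrite mule1 (lamT y A)//; congr (lam _); apply/seteqP; split => x.
        by move=> /set_mem[].
      by move=> Axy; apply/mem_set; split => //; exact: set_mem.
    rewrite mule0 (_ : ysection _ _ = set0) ?measure0// -subset0 => x.
    by move=> /set_mem[_ By]; move: yB; rewrite mem_set.
  rewrite ge0_integralZl//; last exact/measurable_EFinP.
  by rewrite integral_indic// setIT.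
transitivity ((lam \x nu) E2).
  apply: eq_integral => x _ /=.
  rewrite (nuT (- x)%R (xsection E1 x)); last exact: measurable_xsection.
  congr (nu _); apply/seteqP; split => y.
    by move=> /set_mem[/=]; rewrite addrC subrK => Ay By; apply/mem_set.
  by move=> /set_mem[/= Ay By]; apply/mem_set; split => //=; rewrite addrC subrK.
rewrite sw// (eq_integral (fun y => lam B * (\1_A y)%:E)); last first.
  move=> y _; rewrite indicE; have [yA|yA] := boolP (y \in A).
    rewrite mule1 (lamT (- y)%R B)//; congr (lam _); apply/seteqP; split => x.
      by move=> /set_mem[_ /symB /=]; rewrite opprB.
    by move=> /symB /=; rewrite opprB => ?; apply/mem_set; split => //; exact: set_mem.
  rewrite mule0 (_ : ysection _ _ = set0) ?measure0// -subset0 => x.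
  by move=> /set_mem[Ay _]; move: yA; rewrite mem_set.
rewrite ge0_integralZl//; last exact/measurable_EFinP.
by rewrite integral_indic// setIT muleC.
Qed.

End haar.

(** * Open sets and continuous functions are measurable *)

Section borel_rows.
Variable R : realType.

Lemma measurable_fun_mulmx m n (B : 'M[R]_(m, n)) :
  measurable_fun setT (fun y : 'rV[R]_m => y *m B).
Proof.
apply: measurable_fun_row => i; under eq_fun do rewrite mxE.
apply: measurable_sum => j; apply: measurable_funM => //.
exact: measurable_coord.
Qed.

(** Cubes are a neighbourhood base; the measure of a cube is known. *)
Lemma nbhs_cube n (x : 'rV[R]_n) (U : set 'rV[R]_n) : nbhs x U ->
  exists2 r : R, 0 < r & forall z, cube R n r (z - x) -> U z.
Proof.
move=> /nbhs_ballP[e /= e0 sub]; exists (e / 2); first by rewrite divr_gt0.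
move=> z cz; apply: sub; split => // i j; rewrite (ord1 i).
have := cz j; rewrite !mxE /ball/= distrC => /le_lt_trans; apply.
by rewrite ltr_pdivrMr// ltr_pMr// ltrDl.
Qed.

(** The sigma-algebra of row vectors is generated by coordinates, so an open set has to
    be written as a countable union of cubes, with rational centres and radii 1/(m+1). *)
Lemma open_row_measurable n (U : set 'rV[R]_n) : open U -> measurable U.
Proof.
move=> oU.
pose box (q : 'rV[rat]_n * nat) : set 'rV[R]_n :=
  (fun x => x - map_mx ratr q.1) @^-1` cube R n q.2.+1%:R^-1.
have mbox q : measurable (box q).
  rewrite -[X in measurable X]setTI; apply: measurable_fun_translate => //.
  exact: measurable_cube.
have -> : U = \bigcup_(q in [set q | box q `<=` U]) box q.
  apply/seteqP; split => [x Ux|x [q sub]]; last exact: sub.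
  have [r r0 sub] := nbhs_cube (open_nbhs_nbhs (conj oU Ux)).
  (* a cube of radius 1/(m+1) containing x has all its points within 2/(m+1) < r of x *)
  pose m := Num.truncn (2 / r).
  have mr : m.+1%:R^-1 < r / 2 :> R.
    by rewrite -[r / 2]invrK ltf_pV2 ?posrE ?invr_gt0 ?divr_gt0// invf_div truncnS_gt.
  have m0 : 0 < m.+1%:R^-1 :> R by rewrite invr_gt0.
  have /choice[q qx] : forall i, exists q : rat, `|x ord0 i - ratr q| <= m.+1%:R^-1.
    move=> i; have [|q] := @rat_in_itvoo R (x ord0 i) (x ord0 i + m.+1%:R^-1).
      by rewrite ltrDl.
    rewrite in_itv/= => /andP[q1 q2]; exists q.
    by rewrite distrC ger0_norm ?subr_ge0 ?(ltW q1)// lerBlDl ltW.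
  exists (\row_i q i, m); last by move=> i; rewrite !mxE; exact: qx.
  move=> /= z zb; apply: sub => i; rewrite !mxE.
  have := zb i; have := qx i; rewrite !mxE /= => h1 h2.
  rewrite (_ : z ord0 i - x ord0 i = (z ord0 i - ratr (q i)) - (x ord0 i - ratr (q i))); last first.
    by rewrite opprB addrA subrK.
  rewrite (le_trans (ler_normB _ _))// (le_trans (lerD h2 h1))//.
  by rewrite (le_trans (lerD (ltW mr) (ltW mr)))// -splitr.
rewrite bigcup_mkcond; apply: countable_bigcupT_measurable => [|q]; first exact: countableP.
by case: ifP.
Qed.

Lemma closed_row_measurable n (A : set 'rV[R]_n) : closed A -> measurable A.
Proof. by move/closed_openC/open_row_measurable/measurableC; rewrite setCK. Qed.

Lemma continuous_row_measurable n (f : 'rV[R]_n -> R) : continuous f ->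
  measurable_fun setT (f : 'rV[R]_n -> measurableTypeR R).
Proof.
move=> /continuousP cf; apply: (measurability _ (RGenOpens.measurableE R)).
move=> _ [_ [a [b ->] <-]]; rewrite setTI; apply: open_row_measurable.
exact/cf/interval_open.
Qed.

End borel_rows.

(** * The Euclidean norm and rotation invariance *)

Section euclidean_norm.
Variable R : realType.

Lemma enormE n (x : 'rV[R]_n) : enorm x ^+ 2 = (x *m x^T) ord0 ord0.
Proof.
rewrite sqr_sqrtr ?sumr_ge0// => [|i _]; last by rewrite sqr_ge0.
by rewrite mxE; apply: eq_bigr => i _; rewrite mxE.
Qed.

Lemma enorm_ge0 n (x : 'rV[R]_n) : 0 <= enorm x.
Proof. exact: sqrtr_ge0. Qed.

Lemma enormZ n (t : R) (x : 'rV[R]_n) : enorm (t *: x) = `|t| * enorm x.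
Proof.
rewrite /enorm -sqrtr_sqr -sqrtrM ?sqr_ge0// mulr_sumr; congr Num.sqrt.
by apply: eq_bigr => i _; rewrite mxE exprMn.
Qed.

Lemma ler_coord_enorm n (x : 'rV[R]_n) i : `|x ord0 i| <= enorm x.
Proof.
rewrite -sqrtr_sqr ler_wsqrtr// (bigD1 i)//= lerDl sumr_ge0// => j _.
exact: sqr_ge0.
Qed.

Lemma enorm_eq0 n (x : 'rV[R]_n) : (enorm x == 0) = (x == 0).
Proof.
apply/eqP/eqP => [x0|->]; last first.
  by rewrite -(scale0r 0) enormZ normr0 mul0r.
apply/rowP => i; rewrite mxE; apply/eqP; rewrite -normr_le0 -x0.
exact: ler_coord_enorm.
Qed.

Lemma enorm_gt0 n (x : 'rV[R]_n) : (0 < enorm x) = (x != 0).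
Proof. by rewrite lt_def enorm_ge0 andbT enorm_eq0. Qed.

Lemma continuous_enorm n : continuous (@enorm R n).
Proof.
have cS : continuous (fun x : 'rV[R]_n => \sum_i x ord0 i ^+ 2).
  apply: continuous_big => [|i _ x]; first exact: add_continuous.
  apply: (@continuous_comp _ _ _ (fun x : 'rV[R]_n => x ord0 i) (fun t => t ^+ 2)).
    exact: coord_continuous.
  exact: exprn_continuous.
move=> x; apply: (@continuous_comp _ _ _ (fun x : 'rV[R]_n => \sum_i x ord0 i ^+ 2) Num.sqrt).
  exact: cS.
exact: sqrt_continuous.
Qed.

Lemma enorm_isometry m n (B : 'M[R]_(m, n)) (y : 'rV[R]_m) : B *m B^T = 1%:M ->
  enorm (y *m B) = enorm y.
Proof.
move=> BB; apply/eqP; rewrite -(eqrXn2 (n := 2))// ?enorm_ge0// !enormE.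
by rewrite trmx_mul -mulmxA (mulmxA B) BB mul1mx.
Qed.

Lemma enorm_normalize n (x : 'rV[R]_n) : x != 0 -> enorm (normalize x) = 1.
Proof.
move=> x0; rewrite /normalize enormZ ger0_norm ?invr_ge0 ?enorm_ge0//.
by rewrite mulVf// enorm_eq0.
Qed.

Lemma measurable_unit_ball n : measurable (unit_ball R n).
Proof.
have := @measurable_enorm R n measurableT _ (measurable_itv `]-oo, 1%R]).
by rewrite setTI; congr measurable; apply/seteqP; split => x /=; rewrite in_itv.
Qed.

Lemma unit_ball_cube n : unit_ball R n `<=` cube R n 1.
Proof. by move=> x x1 i; exact: le_trans (ler_coord_enorm x i) _. Qed.

Lemma lebesgue_row_bounded n (A : set 'rV[R]_n) r :
    0 <= r -> measurable A -> A `<=` cube R n r ->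
  (lebesgue_row R n A < +oo)%E.
Proof.
move=> r0 mA Ar; rewrite (@le_lt_trans _ _ (lebesgue_row R n (cube R n r)))//.
  by apply: le_measure; rewrite ?inE//; exact: measurable_cube.
by rewrite lebesgue_row_cube// ltry.
Qed.

Lemma lebesgue_row_nbhs n (x : 'rV[R]_n) (A : set 'rV[R]_n) : measurable A -> nbhs x A ->
  (0 < lebesgue_row R n A)%E.
Proof.
move=> mA /nbhs_cube[r r0 rA].
apply: (@lt_le_trans _ _ (lebesgue_row R n ((fun z => z - x) @^-1` cube R n r))).
  rewrite -lebesgue_row_translate; last exact: measurable_cube.
  by rewrite lebesgue_row_cube ?ltW// lte_fin exprn_gt0// mulr_gt0.
apply: le_measure; rewrite ?inE//.
by rewrite -[X in measurable X]setTI; apply: measurable_fun_translate => //; exact: measurable_cube.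
Qed.

Lemma lebesgue_row_unit_ball n : (0 < lebesgue_row R n (unit_ball R n) < +oo)%E.
Proof.
apply/andP; split; last first.
  apply: (@lebesgue_row_bounded _ _ 1) => //; first exact: measurable_unit_ball.
  exact: unit_ball_cube.
apply: (@lebesgue_row_nbhs _ 0); first exact: measurable_unit_ball.
have oB : open [set x : 'rV[R]_n | enorm x < 1].
  have /continuousP/(_ [set t | t < 1]) := @continuous_enorm n.
  by apply; exact: open_lt.
apply: (@filterS _ _ _ [set x : 'rV[R]_n | enorm x < 1]) => [x /ltW//|].
apply: open_nbhs_nbhs; split => //=.
by rewrite (_ : enorm 0 = 0)// ?ltr01//; apply/eqP; rewrite enorm_eq0.
Qed.

(** The image of Lebesgue measure under an orthogonal map is translation invariant,
    hence proportional to Lebesgue measure; the unit ball is mapped to itself, so the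
    factor is 1. *)
Lemma lebesgue_row_orthogonal n (O : 'M[R]_n) (A : set 'rV[R]_n) :
    O *m O^T = 1%:M -> measurable A ->
  lebesgue_row R n ((fun y => y *m O) @^-1` A) = lebesgue_row R n A.
Proof.
move=> OO mA.
have mO := @measurable_fun_mulmx R n n O.
pose nu : set 'rV[R]_n -> \bar R := pushforward (lebesgue_row R n) (fun y => y *m O).
have sfnu : sigma_finite setT nu.
  exists (fun i => (fun y => y *m O^T) @^-1` cube R n i%:R).
    apply/esym; rewrite -subTset => x _.
    have [i _ xi] : (\bigcup_i cube R n i%:R) (x *m O^T) by rewrite bigcup_cube.
    by exists i.
  move=> i; split.
    by rewrite -[X in measurable X]setTI; apply: measurable_fun_mulmx => //; exact: measurable_cube.
  rewrite /nu /pushforward.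
  rewrite [X in lebesgue_row R n X](_ : _ = cube R n i%:R).
    by rewrite lebesgue_row_cube// ltry.
  by apply/seteqP; split => y /=; rewrite -mulmxA OO mulmx1.
pose nuM : {measure set 'rV[R]_n -> \bar R} := image_measure (lebesgue_row R n) mO.
pose nuS : {sigma_finite_measure set 'rV[R]_n -> \bar R} :=
  HB.pack (Measure.sort nuM) (Measure.class nuM)
    (@Measure_isSigmaFinite.Build _ _ _ (Measure.sort nuM) sfnu).
have mB := @measurable_unit_ball n.
have nuB : nu (unit_ball R n) = lebesgue_row R n (unit_ball R n).
  rewrite /nu /pushforward; congr (lebesgue_row R n _).
  by apply/seteqP; split => y; rewrite /unit_ball/= enorm_isometry.
have := @translation_invariant_unique R n (@lebesgue_rowf R n) nuS A (unit_ball R n).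
have -> : nuS (unit_ball R n) = lebesgue_row R n (unit_ball R n) by exact: nuB.
have /andP[B0 Boo] := lebesgue_row_unit_ball n.
have Bfin : (lebesgue_row R n (unit_ball R n)) \is a fin_num by rewrite ge0_fin_numE.
move=> /(_ _ _ _ mA mB) H; apply/esym.
have {}H : (lebesgue_row R n A * lebesgue_row R n (unit_ball R n) =
    nuS A * lebesgue_row R n (unit_ball R n))%E.
  apply: H.
  - by move=> a C mC; exact: lebesgue_row_translate.
  - move=> a C mC.
    transitivity (lebesgue_row R n ((fun y => y *m O) @^-1` C)) => //.
    rewrite (lebesgue_row_translate (a *m O^T)).
      congr (lebesgue_row R n _).
      by apply/seteqP; split => y /=; rewrite mulmxDl -mulmxA (mulmx1C OO) mulmx1.
    by rewrite -[X in measurable X]setTI; exact: (measurable_fun_mulmx O measurableT mC).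
  - by move=> x; rewrite /unit_ball/= -scaleN1r enormZ normrN1 mul1r.
move: H; rewrite -(fineK Bfin).
move=> /(congr1 (fun z => (z * ((fine (lebesgue_row R n (unit_ball R n)))^-1)%:E)%E)).
rewrite -!muleA -!EFinM divff ?mule1// gt_eqF// fine_gt0//.
by rewrite B0.
Qed.

End euclidean_norm.

(** * Star bodies as sublevel sets of gauges *)

Section star_body_gauge.
Variables (R : realType) (n : nat).
Implicit Types (K : set 'rV[R]_n) (u x : 'rV[R]_n).

Lemma scalerl_continuous u : continuous (fun t : R => t *: u).
Proof. by move=> t; exact: scalel_continuous. Qed.

(** The point is the supremum of the elements of T below t0. *)
Lemma last_point_before (T : set R) (s t0 : R) : closed T -> T s -> s < t0 -> ~ T t0 ->
  exists t1, [/\ s <= t1, t1 < t0, T t1 & forall t, t1 < t <= t0 -> ~ T t].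
Proof.
move=> cT Ts st0 nT0; pose S := T `&` [set t | t <= t0].
have S0 : S !=set0 by exists s; split => //=; exact: ltW.
have cS : closed S by apply: closedI => //; exact: closed_le.
have uS : has_ubound S by exists t0 => t [].
have hS : has_sup S by [].
have [Tt1 t1t0] : S (sup S) by apply: cS; exact: closure_sup.
exists (sup S); split => //.
- by apply: sup_upper_bound => //; split => //=; exact: ltW.
- by rewrite lt_neqAle t1t0 andbT; apply/eqP => e; rewrite e in Tt1.
- move=> t /andP[t1t tt0] Tt; have := sup_upper_bound hS (x := t).
  by move=> /(_ (conj Tt tt0)); rewrite leNgt t1t.
Qed.

Definition ray_boundary K u (t : R) := (closure K `\` K°) (t *: u).

(** Leaving the closed set K between s and t0 forces a boundary point in between. *)
Lemma ray_last_point K u s t0 : closed K -> K (s *: u) -> s < t0 -> ~ K (t0 *: u) ->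
  exists t1, [/\ s <= t1, t1 < t0, K (t1 *: u), ray_boundary K u t1 &
    forall t, t1 < t <= t0 -> ~ K (t *: u)].
Proof.
move=> cK Ks st0 Kt0; pose T := (fun t : R => t *: u) @^-1` K.
have cT : closed T.
  by apply: preimage_closed => // t _; exact: scalerl_continuous.
have [t1 [st1 t10 Tt1 T1]] := last_point_before cT Ks st0 Kt0.
exists t1; split => //; split; first exact: subset_closure.
move=> Kt1; have : nbhs t1 T by apply: (scalerl_continuous Kt1).
move=> /nbhs_ballP[e /= e0 sub].
pose t := Num.min t0 (t1 + e / 2).
have t1t : t1 < t by rewrite lt_min t10 ltrDl divr_gt0.
apply: (T1 t); first by rewrite t1t ge_min lexx.
apply: sub; rewrite /ball/= distrC ger0_norm ?subr_ge0 ?ltW//.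
rewrite ltrBlDl (@le_lt_trans _ _ (t1 + e / 2))//; first by rewrite ge_min lexx orbT.
by rewrite ltrD2l ltr_pdivrMr// ltr_pMr// ltrDl.
Qed.

Lemma star_body0 K : star_body K -> K 0.
Proof. by move=> [_ _ _ K0 _]; exact: interior_subset. Qed.

Lemma star_body_bounded K u : star_body K -> u != 0 ->
  exists2 C : R, 0 < C & forall t, K (t *: u) -> `|t| < C.
Proof.
move=> [_ [M [Mr bK]] _ _ _] u0.
have nu0 : 0 < `|u| by rewrite normr_gt0.
exists ((`|M| + 1) / `|u| + 1) => [|t Kt].
  by rewrite ltr_wpDl// divr_ge0// addr_ge0.
have := bK (`|M| + 1); rewrite (le_lt_trans (ler_norm M)) ?ltrDl// => /(_ isT _ Kt).
rewrite /= normrZ -ler_pdivlMr// => /le_lt_trans; apply.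
by rewrite ltrDl.
Qed.

(** This is where the condition on lines is used.  The last point of K on each of the two
    rays from the origin is a boundary point.  If the positive ray left K and came back,
    the point where it first left would be a third one. *)
Lemma star_body_ray K u : star_body K -> u != 0 ->
  exists2 tau : R, 0 < tau & forall t, 0 <= t -> (K (t *: u) <-> t <= tau).
Proof.
move=> sK u0; have [cK _ lines K0 _] := sK.
have [C C0 KC] := star_body_bounded sK u0.
have KC1 t : C <= `|t| -> ~ K (t *: u).
  by move=> Ct /KC; rewrite ltNge Ct.
have [e e0 Ke] : exists2 e : R, 0 < e & forall t, `|t| < e -> K (t *: u).
  have : nbhs (0 : R) ((fun t : R => t *: u) @^-1` K).
    by apply: scalerl_continuous; rewrite scale0r.
  move=> /nbhs_ballP[e /= e0 sub]; exists e => // t te; apply: sub.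
  by rewrite /ball/= sub0r normrN.
have Ke2 : K ((e / 2) *: u).
  by apply: Ke; rewrite gtr0_norm ?divr_gt0// ltr_pdivrMr// ltr_pMr// ltrDl.
have eC : e / 2 < C by apply: le_lt_trans (ler_norm _) _; exact: KC.
have Kme2 : K ((e / 2) *: (- u)).
  rewrite scalerN -scaleNr; apply: Ke.
  by rewrite normrN gtr0_norm ?divr_gt0// ltr_pdivrMr// ltr_pMr// ltrDl.
have [|tau [etau tauC Ktau btau ltau]] := @ray_last_point K u _ C cK Ke2 eC.
  by apply: KC1; rewrite gtr0_norm.
(* the point -s of the line is the boundary point on the negative ray *)
have [|s [es sC Ks bs ls]] := @ray_last_point K (- u) _ C cK Kme2 eC.
  by rewrite scalerN -scaleNr; apply: KC1; rewrite normrN gtr0_norm.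
have tau0 : 0 < tau by apply: lt_le_trans etau; rewrite divr_gt0.
have s0 : 0 < s by apply: lt_le_trans es; rewrite divr_gt0.
exists tau => // t t0; split => [Kt|ttau].
  rewrite leNgt; apply/negP => taut; apply: (ltau t) => //.
  by rewrite taut/= ltW//; apply: le_lt_trans (ler_norm _) _; exact: KC.
have [//|nKt] := pselect (K (t *: u)).
have et : e / 2 < t.
  rewrite ltNge; apply/negP => te; apply: nKt; apply: Ke; rewrite ger0_norm//.
  by apply: le_lt_trans te _; rewrite ltr_pdivrMr// ltr_pMr// ltrDl.
(* t1 < tau is a third boundary parameter besides tau and -s *)
have [t1 [et1 t1t Kt1 bt1 lt1]] := @ray_last_point K u _ t cK Ke2 et nKt.
have t10 : 0 < t1 by apply: lt_le_trans et1; rewrite divr_gt0.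
have [p [q [pq Epq]]] := lines u u0.
have E r : r != 0 -> ray_boundary K u r -> r *: u = p \/ r *: u = q.
  move=> r0 br; suff : [set p; q] (r *: u) by [].
  rewrite -Epq; split => /=; first by split => //; exists r.
  by apply/eqP; rewrite scaler_eq0 negb_or r0.
have inj a b : a *: u = b *: u -> a = b.
  by move=> /eqP; rewrite -subr_eq0 -scalerBl scaler_eq0 (negbTE u0) orbF subr_eq0 => /eqP.
have es' : - s *: u = s *: (- u) by rewrite scaleNr scalerN.
have bs' : ray_boundary K u (- s) by rewrite /ray_boundary es'; exact: bs.
have t1tau : t1 < tau by apply: lt_le_trans t1t _.
have := E _ (lt0r_neq0 tau0) btau; have := E _ (lt0r_neq0 t10) bt1.
have := E (- s) _ bs'; rewrite oppr_eq0 (lt0r_neq0 s0) => /(_ isT).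
have F a b c : a < b -> a *: u = c -> b *: u = c -> False.
  by move=> ab <- /inj ba; rewrite ba ltxx in ab.
have st1 : - s < t1 by apply: lt_trans t10; rewrite oppr_lt0.
have stau : - s < tau by apply: lt_trans tau0; rewrite oppr_lt0.
(* two of the three distinct parameters would give the same point p or q *)
by move=> [] h1 [] h2 [] h3; exfalso;
  [exact: F st1 h1 h2|exact: F st1 h1 h2|exact: F stau h1 h3|exact: F t1tau h2 h3|
   exact: F t1tau h2 h3|exact: F stau h1 h3|exact: F st1 h1 h2|exact: F st1 h1 h2].
Qed.

Lemma minkowski_ray K u (tau : R) : 0 < tau -> u != 0 ->
  (forall t, 0 <= t -> (K (t *: u) <-> t <= tau)) -> Defs.minkowski K u = tau^-1.
Proof.
move=> tau0 u0 Ktau; rewrite /Defs.minkowski.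
have -> : [set a | 0 <= a /\ exists2 y, K y & u = a *: y] = [set a | tau^-1 <= a].
  apply/seteqP; split => [a /= [a0 [y Ky uay]]|a /= taua].
    have a1 : 0 < a.
      rewrite lt_neqAle a0 andbT; apply: contraNneq u0 => a00.
      by rewrite uay -a00 scale0r.
    have : K (a^-1 *: u) by rewrite uay scalerA mulVf ?gt_eqF// scale1r.
    by rewrite Ktau ?invr_ge0// => h; rewrite invf_ple.
  have a0 : 0 < a by apply: lt_le_trans taua; rewrite invr_gt0.
  split; first exact: ltW.
  exists (a^-1 *: u); last by rewrite scalerA divff ?gt_eqF// scale1r.
  by apply/Ktau; [rewrite invr_ge0 ltW|rewrite invf_ple].
apply/eqP; rewrite eq_le; apply/andP; split.
  by apply: ge_inf => /=; [exists tau^-1 => a|].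
by apply: lb_le_inf; [exists tau^-1 => /=|move=> a].
Qed.

Lemma minkowski0 K : K 0 -> Defs.minkowski K 0 = 0.
Proof.
move=> K0; apply/eqP; rewrite eq_le; apply/andP; split.
  apply: ge_inf; first by exists 0 => a [].
  by split => //; exists 0; rewrite ?scaler0.
apply: lb_le_inf; first by exists 0; split => //; exists 0; rewrite ?scaler0.
by move=> a [].
Qed.

(** What is used of a Minkowski functional in the integrals below; the Euclidean norm is
    another instance, so that volumes of balls need no separate treatment. *)
Definition gauge (N : 'rV[R]_n -> R) :=
  [/\ measurable_fun setT (N : 'rV[R]_n -> measurableTypeR R),
      (forall t x, 0 < t -> N (t *: x) = t * N x) & (forall x, x != 0 -> 0 < N x)].

Lemma star_body_minkowski_gt0 K x : star_body K -> x != 0 -> 0 < Defs.minkowski K x.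
Proof.
move=> sK x0; have [tau tau0 Ktau] := star_body_ray sK x0.
by rewrite (minkowski_ray tau0)// invr_gt0.
Qed.

Lemma star_body_gauge K : star_body K -> gauge (Defs.minkowski K).
Proof.
move=> sK; split.
- by apply: continuous_row_measurable; case: sK.
- move=> t x t0; have [->|x0] := eqVneq x 0.
    by rewrite scaler0 minkowski0 ?mulr0//; exact: star_body0.
  have [tau tau0 Ktau] := star_body_ray sK x0.
  rewrite (minkowski_ray tau0 x0 Ktau) (@minkowski_ray _ _ (tau / t)) ?divr_gt0//.
  + by rewrite invf_div.
  + by rewrite scaler_eq0 negb_or gt_eqF.
  + move=> s s0; rewrite scalerA Ktau; first by rewrite ler_pdivlMr.
    by rewrite mulr_ge0// ltW.
- by move=> x; exact: star_body_minkowski_gt0.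
Qed.

Lemma star_bodyE K : star_body K -> K = [set x | Defs.minkowski K x <= 1].
Proof.
move=> sK; apply/seteqP; split => x /=; have [->|x0] := eqVneq x 0.
- by rewrite minkowski0//; exact: star_body0.
- have [tau tau0 Ktau] := star_body_ray sK x0.
  rewrite (minkowski_ray tau0)// -{1}(scale1r x) => /Ktau; rewrite ler01 => /(_ isT).
  by rewrite invf_ple ?posrE// invr1.
- by move=> _; exact: star_body0.
- have [tau tau0 Ktau] := star_body_ray sK x0.
  rewrite (minkowski_ray tau0)// => h; rewrite -(scale1r x); apply/Ktau => //.
  by move: h; rewrite invf_ple ?posrE// invr1.
Qed.

Lemma enorm_gauge : gauge (@enorm R n).
Proof.
split; first exact: measurable_enorm.
- by move=> t x t0; rewrite enormZ gtr0_norm.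
- by move=> x; rewrite enorm_gt0.
Qed.

Lemma minkowski_le K L x : star_body K -> star_body L -> L `<=` K ->
  Defs.minkowski K x <= Defs.minkowski L x.
Proof.
move=> sK sL LK; have [->|x0] := eqVneq x 0.
  by rewrite !minkowski0//; exact: star_body0.
have [t t0 Lt] := star_body_ray sL x0; have [s s0 Ks] := star_body_ray sK x0.
rewrite (minkowski_ray s0)// (minkowski_ray t0)// lef_pV2 ?posrE//.
have t0' := ltW t0; apply/(Ks t t0')/LK.
exact/(Lt t t0').
Qed.

End star_body_gauge.

(** * Polar coordinates for homogeneous measures *)

Section polar_coordinates.
Context (R : realType) (n d : nat).
Variable mu : {measure set 'rV[R]_n -> \bar R}.
Hypothesis d_gt0 : (0 < d)%N.
Hypothesis mu_scale : forall t A, 0 < t -> measurable A ->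
  (mu A = (t ^+ d)%:E * mu ((fun x => t *: x) @^-1` A))%E.
Local Open Scope ereal_scope.

Lemma measurable_preimage_scale (t : R) (A : set 'rV[R]_n) : measurable A ->
  measurable ((fun x => t *: x)%R @^-1` A).
Proof.
by move=> mA; rewrite -[X in measurable X]setTI; exact: measurable_fun_scale.
Qed.

(** As t A is contained in B and B in A, t^d mu A <= mu B <= mu A; now let t tend to 1.
    This discards the boundaries of balls, cones and star bodies. *)
Lemma homogeneous_interior_measure (A B : set 'rV[R]_n) :
    measurable A -> measurable B -> B `<=` A ->
    (forall t x, (0 < t < 1)%R -> A x -> B (t *: x)%R) ->
  mu B = mu A.
Proof.
move=> mA mB BA AB; apply/eqP; rewrite eq_le le_measure ?inE//=.
rewrite leNgt; apply/negP => BltA.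
have H (t : R) : (0 < t < 1)%R -> (t ^+ d)%:E * mu A <= mu B.
  move=> /[dup] t01 /andP[t0 t1]; rewrite (mu_scale t0 mB).
  rewrite lee_pmul2l//; last by rewrite lte_fin exprn_gt0.
  apply: le_measure; rewrite ?inE//; first exact: measurable_preimage_scale.
  by move=> x Ax; exact: AB.
have Bfin : mu B \is a fin_num by rewrite ge0_fin_numE ?measure_ge0// (lt_le_trans BltA)// leey.
have rootd (c : R) : (0 < c < 1)%R -> exists2 t : R, (0 < t < 1)%R & (t ^+ d = c)%R.
  move=> /andP[c0 c1]; exists (c `^ d%:R^-1)%R.
    have : (c `^ d%:R^-1 < 1 `^ d%:R^-1)%R.
      by rewrite gt0_ltr_powR ?nnegrE ?invr_gt0 ?ltr0n// ltW.
    by rewrite powR1 powR_gt0.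
  rewrite -powR_mulrn ?powR_ge0// -powRrM mulVf ?pnatr_eq0 -?lt0n// powRr1//.
  exact: ltW.
have muB0 : (0 <= fine (mu B))%R by rewrite fine_ge0// measure_ge0.
have [Afin|] := boolP (mu A \is a fin_num); last first.
  rewrite ge0_fin_numE ?measure_ge0// -leNgt leye_eq => /eqP Aoo.
  have h2 : (0 < (2^-1 : R) < 1)%R by rewrite invr_gt0 ltr0n/= invf_lt1 ?ltr1n.
  have [t /andP[t0 t1] _] := rootd _ h2.
  have := H t; rewrite t0 t1 Aoo => /(_ isT); rewrite gt0_muley ?lte_fin ?exprn_gt0//.
  by rewrite leye_eq => /eqP Boo; rewrite Boo in Bfin.
move: BltA H; rewrite -(fineK Afin) -(fineK Bfin) lte_fin.
set a := fine (mu A); set b := fine (mu B) => ba H.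
have a0 : (0 < a)%R by apply: le_lt_trans ba.
(* t^d a is then the midpoint of b = mu B and a = mu A, which exceeds b. *)
have [|t t01 tc] := rootd ((b + a) / 2 / a)%R.
  rewrite !divr_gt0 ?ltr_wpDl//= ltr_pdivrMr// mul1r ltr_pdivrMr//.
  by rewrite mulr_natr mulr2n ltrD2r.
have := H t t01; rewrite tc -EFinM lee_fin divfK ?gt_eqF//.
by rewrite leNgt ltr_pdivlMr// mulr_natr mulr2n ltrD2l ba.
Qed.

Lemma measurable_cone (A : set 'rV[R]_n) (c : R) : measurable A ->
  measurable [set x : 'rV[R]_n | [/\ 0 < enorm x, A (normalize x) & enorm x < c]%R].
Proof.
move=> mA.
have -> : [set x : 'rV[R]_n | [/\ 0 < enorm x, A (normalize x) & enorm x < c]%R] =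
  (@enorm R n @^-1` `]0%R, c[) `&` (@normalize R n @^-1` A).
  apply/seteqP; split => x /=; rewrite in_itv/=; last by move=> [/andP[? ?] ?]; split.
  by move=> [x0 Ax xc]; rewrite x0 xc.
apply: measurableI; rewrite -[X in measurable X]setTI.
  exact: measurable_enorm.
exact: measurable_normalize.
Qed.

Lemma normalizeZ (t : R) (x : 'rV[R]_n) : (0 < t)%R -> normalize (t *: x) = normalize x.
Proof.
move=> t0; rewrite /normalize enormZ gtr0_norm// scalerA invfM.
by rewrite mulrAC mulVf ?mul1r// gt_eqF.
Qed.

Let sigma := image_measure (mrestr mu (@measurable_pball R n)) (@measurable_normalize R n).

(** The points lying in polar coordinates under the graph of h, with the radius measured
    by its d-th power; the strict inequality makes this set depend continuously on
    increasing sequences of h. *)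
Definition subgraph (h : 'rV[R]_n -> R) :=
  [set x : 'rV[R]_n | (0 < enorm x)%R /\ (enorm x ^+ d < h (normalize x))%R].

Lemma measurable_subgraph (h : 'rV[R]_n -> R) :
  measurable_fun setT (h : 'rV[R]_n -> measurableTypeR R) -> measurable (subgraph h).
Proof.
move=> mh.
have -> : subgraph h = (@enorm R n @^-1` `]0%R, +oo[) `&`
    ((fun x => h (normalize x) - enorm x ^+ d : measurableTypeR R)%R @^-1` `]0%R, +oo[).
  apply/seteqP; split => x; rewrite /subgraph/= !in_itv/= !andbT subr_gt0; exact.
apply: measurableI; rewrite -[X in measurable X]setTI.
  exact: measurable_enorm.
have mf : measurable_fun setT (fun x => h (normalize x) - enorm x ^+ d : measurableTypeR R)%R.
  apply: measurable_funB; first by apply: measurableT_comp => //; exact: measurable_normalize.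
  by apply: measurable_funX; exact: measurable_enorm.
exact: mf.
Qed.

(** The integral of the constant c over the directions A is the measure of a cone: the cone
    over A of radius c^(1/d) is a dilation of the cone of radius 1. *)
Lemma polar_level (A : set 'rV[R]_n) (c : R) : (0 <= c)%R -> measurable A ->
  c%:E * sigma A =
  mu [set x | [/\ 0 < enorm x, A (normalize x) & enorm x ^+ d < c]%R].
Proof.
rewrite le_eqVlt => /predU1P[<- mA|c0 mA].
  rewrite mul0e (_ : mkset _ = set0) ?measure0// -subset0 => x [/= x0 _].
  by rewrite ltNge exprn_ge0// ltW.
pose t := (c `^ d%:R^-1)%R.
have t0 : (0 < t)%R by exact: powR_gt0.
have tc : (t ^+ d = c)%R.
  by rewrite -powR_mulrn ?powR_ge0// -powRrM mulVf ?pnatr_eq0 -?lt0n// powRr1// ltW.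
have -> : [set x : 'rV[R]_n | [/\ 0 < enorm x, A (normalize x) & enorm x ^+ d < c]%R] =
    [set x : 'rV[R]_n | [/\ 0 < enorm x, A (normalize x) & enorm x < t]%R].
  apply/seteqP; split => x [x0 Ax /= xc]; split => //=.
    by rewrite ltNge; apply/negP => tx; move: xc; rewrite -tc ltNge lerXn2r// nnegrE ltW.
  by rewrite -tc ltrXn2r -?lt0n// ?nnegrE ltW.
rewrite (mu_scale t0); last exact: measurable_cone.
rewrite tc; congr (_ * _).
have -> : (fun x : 'rV[R]_n => t *: x)%R @^-1`
    [set x : 'rV[R]_n | [/\ 0 < enorm x, A (normalize x) & enorm x < t]%R]
  = [set x : 'rV[R]_n | [/\ 0 < enorm x, A (normalize x) & enorm x < 1]%R].
  have tE x : (enorm (t *: x) < t)%R = (enorm x < 1)%R.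
    by rewrite enormZ gtr0_norm// gtr_pMr.
  have t0E x : (0 < enorm (t *: x))%R = (0 < enorm x)%R.
    by rewrite enormZ gtr0_norm// pmulr_rgt0.
  by apply/seteqP; split => x /=; rewrite tE t0E normalizeZ.
pose E := @normalize R n @^-1` A `&` [set x | (0 < enorm x <= 1)%R].
transitivity (mu E) => //; apply/esym; apply: homogeneous_interior_measure.
- apply: measurableI; last exact: measurable_pball.
  by rewrite -[X in measurable X]setTI; exact: measurable_normalize.
- exact: measurable_cone.
- by move=> x [x0 Ax /ltW x1]; split => //=; rewrite x0.
- move=> s x /andP[s0 s1] [Ax /= /andP[x0 x1]]; rewrite /= normalizeZ// enormZ gtr0_norm//.
  split=> //; first by rewrite mulr_gt0.
  by rewrite (le_lt_trans (ler_wpM2l (ltW s0) x1))// mulr1.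
Qed.

Import HBNNSimple.

(** The region under the graph of a simple function is a disjoint union of cones over its
    level sets. *)
Lemma polar_nnsfun (f : {nnsfun 'rV[R]_n >-> R}) :
  \int[sigma]_x (f x)%:E = mu (subgraph f).
Proof.
rewrite integralT_nnsfun sintegralE.
have mf c : measurable (f @^-1` [set c]) by [].
pose V c := [set x : 'rV[R]_n |
  [/\ 0 < enorm x, (f @^-1` [set c]) (normalize x) & enorm x ^+ d < c]%R].
have -> : subgraph f = \bigcup_(c in range f) V c.
  apply/seteqP; split => x.
    by move=> [x0 xf]; exists (f (normalize x)).
  by move=> [c _ [x0 /= fc xc]]; split => //; rewrite fc.
rewrite measure_fin_bigcup//.
- apply: eq_fsbigr => c; rewrite inE => -[x _ <-].
  by rewrite polar_level.
- move=> c c' _ _ [x [[_ /= <- _] [_ /= <- _]]] => //.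
- move=> c [y _ <-].
  have -> : V (f y) = subgraph (fun x => f y * \1_(f @^-1` [set f y]) x)%R.
    apply/seteqP; split => x /=.
      move=> [x0 /= fx xf]; split => //.
      by rewrite indicE mem_set// mulr1.
    move=> [x0]; rewrite indicE; case: (boolP (_ \in _)) => [/set_mem/= fx|_].
      by rewrite mulr1.
    by rewrite mulr0 ltNge exprn_ge0// ltW.
  by apply: measurable_subgraph; apply: measurable_funM.
Qed.

(** Both sides are continuous along the simple functions increasing to h. *)
Lemma polar_integral (h : 'rV[R]_n -> R) :
    measurable_fun setT (h : 'rV[R]_n -> measurableTypeR R) -> (forall x, 0 <= h x)%R ->
  \int[sigma]_x (h x)%:E = mu (subgraph h).
Proof.
move=> mh h0.
have mEh : measurable_fun setT (EFin \o h) by exact/measurable_EFinP.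
pose f := nnsfun_approx measurableT mEh.
have fh x : EFin \o f ^~ x @ \oo --> (h x)%:E.
  by apply: cvg_nnsfun_approx => //= y _; rewrite lee_fin.
have ndf : nondecreasing_seq (f : ('rV[R]_n -> R)^nat) by exact: nd_nnsfun_approx.
have ndx x : nondecreasing_seq (f ^~ x) by move=> a b ab; exact/lefP/ndf.
have fr x : f ^~ x @ \oo --> h x by exact: (fine_cvg (fh x)).
have fle m x : (f m x <= h x)%R.
  by have := nondecreasing_cvgn_le (ndx x) (cvgP _ (fr x)) m; rewrite (cvg_lim _ (fr x)).
have -> : \int[sigma]_x (h x)%:E = limn (sintegral sigma \o f).
  by apply: nd_ge0_integral_lim.
have -> : sintegral sigma \o f = mu \o (fun m => subgraph (f m)).
  apply/funext => m; exact: (etrans (esym (integralT_nnsfun sigma (f m))) (polar_nnsfun (f m))).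
apply/cvg_lim => //.
have msub m : measurable (subgraph (f m)).
  by apply: measurable_subgraph; exact: (measurable_funPT (f m)).
rewrite (_ : subgraph h = \bigcup_m subgraph (f m)).
  apply: nondecreasing_cvg_mu => //; first exact: bigcupT_measurable.
  move=> a b ab; apply/subsetPset => x [x0 xf]; split => //.
  by apply: lt_le_trans xf _; exact: ndx.
apply/seteqP; split => x; last first.
  by move=> [m _ [x0 xf]]; split => //; apply: lt_le_trans xf _.
move=> [x0 xh]; have /cvgr_gt/(_ _ xh) := fr (normalize x).
by move=> [N _ /(_ N (leqnn N))] ?; exists N.
Qed.

(** Integration in polar coordinates with respect to the surface measure, for any measure
    homogeneous of degree d: Lebesgue measure of the whole space and of its subspaces
    are both covered. *)
Lemma surface_integral (D : set 'rV[R]_n) (h : 'rV[R]_n -> R) :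
    measurable D -> measurable_fun setT (h : 'rV[R]_n -> measurableTypeR R) ->
    (forall x, 0 <= h x)%R ->
  \int[surface d mu]_(x in D) (h x)%:E =
  d%:R%:E * mu (subgraph h `&` @normalize R n @^-1` D).
Proof.
move=> mD mh h0; rewrite integral_mkcond.
have -> : ((fun x => (h x)%:E) \_ D) = (fun x => (h x * \1_D x)%:E)%R.
  apply/funext => x; rewrite patchE indicE.
  by case: ifPn => _; rewrite ?mulr1 ?mulr0.
have mhD : measurable_fun setT (fun x => h x * \1_D x : measurableTypeR R)%R.
  by apply: measurable_funM.
have hD0 x : (0 <= h x * \1_D x)%R by rewrite mulr_ge0.
rewrite [LHS]ge0_integral_mscale//; last 2 first.
- exact/measurable_EFinP.
- by move=> x _; rewrite lee_fin.
congr (_ * _); rewrite [LHS]polar_integral//; congr (mu _).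
apply/seteqP; split => x /=.
  move=> [x0]; rewrite indicE; case: (boolP (_ \in _)) => [/set_mem ?|_].
    by rewrite mulr1 => ?; split.
  by rewrite mulr0 ltNge exprn_ge0// ltW.
by move=> [[x0 xh] Dx]; split => //; rewrite indicE mem_set// mulr1.
Qed.

End polar_coordinates.

(** * Volume of a gauge body as a spherical integral *)

Section gauge_integral.
Context (R : realType) (n d : nat).
Variable mu : {measure set 'rV[R]_n -> \bar R}.
Hypothesis d_gt0 : (0 < d)%N.
Hypothesis mu_scale : forall t A, 0 < t -> measurable A ->
  (mu A = (t ^+ d)%:E * mu ((fun x => t *: x) @^-1` A))%E.
Hypothesis mu_ball : (mu (unit_ball R n) < +oo)%E.
Local Open Scope ereal_scope.

Lemma gauge0 (N : 'rV[R]_n -> R) : gauge N -> N 0%R = 0%R.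
Proof.
move=> [_ Nh _]; have := Nh 2%R 0%R (ltr0Sn _ _); rewrite scaler0 mulr_natl mulr2n => /eqP.
by rewrite -subr_eq0 opprD addrA subrr add0r oppr_eq0 => /eqP.
Qed.

Lemma gauge_ge0 (N : 'rV[R]_n -> R) x : gauge N -> (0 <= N x)%R.
Proof.
move=> gN; have [->|x0] := eqVneq x 0%R; first by rewrite gauge0.
by case: gN => _ _ /(_ x x0)/ltW.
Qed.

Lemma measurable_gauge_inv (N : 'rV[R]_n -> R) : gauge N ->
  measurable_fun setT (fun x => (N x)^-1 : measurableTypeR R)%R.
Proof.
move=> gN; have [mN _ _] := gN.
under eq_fun do rewrite -powR_inv1 ?gauge_ge0//.
exact: (measurableT_comp (measurable_powR (-1)%R) mN).
Qed.

Lemma measurable_gauge_invX (N : 'rV[R]_n -> R) m : gauge N ->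
  measurable_fun setT (fun x => (N x)^-1 ^+ m : measurableTypeR R)%R.
Proof. by move=> gN; apply: measurable_funX; exact: measurable_gauge_inv. Qed.

Lemma measurable_sphere : measurable (sphere R n).
Proof.
have := @measurable_enorm R n measurableT _ (measurable_set1 (1%R : R)).
by rewrite setTI.
Qed.

Lemma measurable_sublevel (N : 'rV[R]_n -> R) : gauge N ->
  measurable [set x | (N x <= 1)%R].
Proof.
move=> [mN _ _]; have := mN measurableT _ (measurable_itv `]-oo, 1%R]).
by rewrite setTI; congr measurable; apply/seteqP; split => x /=; rewrite in_itv.
Qed.

Lemma measurable_origin : measurable [set 0%R : 'rV[R]_n].
Proof.
have := @measurable_enorm R n measurableT _ (measurable_set1 (0%R : R)).
rewrite setTI; congr measurable; apply/seteqP; split => x /=.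
  by move=> /eqP; rewrite enorm_eq0 => /eqP.
by move=> ->; apply/eqP; rewrite enorm_eq0.
Qed.

(** The origin is fixed by dilations, so its finite mass equals 2^d times itself. *)
Lemma homogeneous_measure_set0 : mu [set 0%R] = 0.
Proof.
have m0 := measurable_origin.
have : mu [set 0%R] < +oo.
  apply: le_lt_trans mu_ball; apply: le_measure; rewrite ?inE//.
    exact: measurable_unit_ball.
  by move=> _ ->; rewrite /unit_ball/= (_ : enorm 0%R = 0%R)//; exact: gauge0 (@enorm_gauge R n).
have := @mu_scale 2%R [set 0%R] (ltr0Sn _ _) m0.
rewrite (_ : _ @^-1` _ = [set 0%R]); last first.
  apply/seteqP; split => x /=; last by move=> ->; rewrite scaler0.
  by move=> /eqP; rewrite scaler_eq0 pnatr_eq0/= => /eqP.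
move=> + lty; have fin : mu [set 0%R] \is a fin_num by rewrite ge0_fin_numE.
rewrite -(fineK fin) -EFinM => -[] /eqP; rewrite -subr_eq0 -{1}(mul1r (fine _)) -mulrBl.
rewrite mulf_eq0 subr_eq0 => /orP[|/eqP->//].
by rewrite lt_eqF// exprn_egt1 ?ltr1n// -lt0n.
Qed.

(** The formula d |K \cap H| = \int rho^d over the sphere of H, for the body {N <= 1}
    with radial function rho = 1 / N.  In polar coordinates |x|^d < N(x / |x|)^-d means
    N x < 1, by homogeneity. *)
Lemma gauge_surface_integral (N : 'rV[R]_n -> R) (H : set 'rV[R]_n) :
    gauge N -> measurable H -> (forall t x, (0 < t)%R -> H x -> H (t *: x)%R) ->
  \int[surface d mu]_(x in sphere R n `&` H) ((N x)^-1 ^+ d)%:E =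
  d%:R%:E * mu ([set x | (N x <= 1)%R] `&` H).
Proof.
move=> gN mH cH; have [mN Nh Np] := gN.
have mS := measurable_sphere.
rewrite (surface_integral d_gt0 mu_scale)//; last 3 first.
- exact: measurableI.
- exact: measurable_gauge_invX.
- by move=> x; rewrite exprn_ge0// invr_ge0 gauge_ge0.
congr (_ * _).
have HN x : (0 < enorm x)%R -> H (normalize x) <-> H x.
  move=> x0; split => Hx; last by apply: cH => //; rewrite invr_gt0.
  have := cH _ _ x0 Hx; rewrite scalerA divff ?scale1r// gt_eqF//.
set A := [set x | (N x <= 1)%R] `&` H.
pose A' := A `\ 0%R.
have mA : measurable A by apply: measurableI => //; exact: measurable_sublevel.
have m0 := measurable_origin.
have mA' : measurable A' by exact: measurableD.
transitivity (mu A'); last first.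
  apply/eqP; rewrite eq_le; apply/andP; split.
    by apply: le_measure; rewrite ?inE//; exact: subDsetl.
  rewrite (@le_trans _ _ (mu (A' `|` [set 0%R])))//.
    apply: le_measure; rewrite ?inE//; first exact: measurableU.
    by move=> x Ax; have [->|/eqP x0] := eqVneq x 0%R; [right|left; split].
  apply: le_trans (measureU2 _ mA' m0) _.
  by rewrite [X in _ + X](_ : _ = 0) ?adde0//; exact: homogeneous_measure_set0.
set B := _ `&` _.
have BE : B = [set x | (0 < enorm x)%R /\ (N x < 1)%R] `&` H.
  have K x : (0 < enorm x)%R -> (enorm x ^+ d < (N (normalize x))^-1 ^+ d)%R = (N x < 1)%R.
    move=> x0; have x0' : x != 0%R by rewrite -enorm_gt0.
    have Nx0 := Np _ x0'.
    rewrite ltr_pXn2r ?nnegrE ?invr_ge0 ?enorm_ge0 ?(gauge_ge0 _ gN)//.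
    rewrite /normalize Nh ?invr_gt0// invfM invrK -{1}(mulr1 (enorm x)) ltr_pM2l//.
    by rewrite -{1}invr1 ltf_pV2 ?posrE.
  apply/seteqP; split => x.
    move=> [[x0]]; rewrite K// => Nx [Sx Hx]; split; first by split.
    exact/HN.
  move=> [[x0 Nx] Hx]; split; first by split => //; rewrite K.
  split; last exact/HN.
  by rewrite /sphere/=; apply: enorm_normalize; rewrite -enorm_gt0.
apply: (homogeneous_interior_measure d_gt0 mu_scale) => //.
- rewrite /B; apply: measurableI.
    by apply: measurable_subgraph => //; exact: measurable_gauge_invX.
  rewrite -[X in measurable X]setTI; apply: measurable_normalize => //.
  exact: measurableI.
- rewrite BE => x [[x0 /ltW Nx] Hx]; split; first by split.
  by move=> /= x00; move: x0; rewrite enorm_gt0 x00 eqxx.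
- rewrite BE => t x /andP[t0 t1] [[/= Nx Hx] /eqP x0]; split; last exact: cH.
  split; first by rewrite enormZ gtr0_norm// mulr_gt0// enorm_gt0.
  by rewrite Nh//; apply: le_lt_trans t1; rewrite -[leRHS]mulr1 ler_wpM2l// ltW.
Qed.

End gauge_integral.

(** * The dual Minkowski inequality *)

Section dual_mixed_volume.
Variable R : realType.

(** The weighted arithmetic-geometric mean inequality, as Young's inequality for x^j and y^l
    with exponents d / j and d / l. *)
Lemma young_nat (j l d : nat) (x y : R) : (0 < j)%N -> (0 < l)%N -> (j + l = d)%N ->
  0 <= x -> 0 <= y -> x ^+ j * y ^+ l <= j%:R / d%:R * x ^+ d + l%:R / d%:R * y ^+ d.
Proof.
move=> j0 l0 jld x0 y0.
have d0 : (0 < d)%N by rewrite -jld addn_gt0 j0.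
have j0' : 0 < j%:R :> R by rewrite ltr0n.
have l0' : 0 < l%:R :> R by rewrite ltr0n.
have d0' : 0 < d%:R :> R by rewrite ltr0n.
have E (z : R) m : 0 <= z -> (0 < m)%N -> (z ^+ m) `^ (d%:R / m%:R) = z ^+ d.
  move=> z0 m0; rewrite -!powR_mulrn// -powRrM mulrCA divff ?mulr1//.
  by rewrite pnatr_eq0 -lt0n.
have := @conjugate_powR R (x ^+ j) (y ^+ l) (d%:R / j%:R) (d%:R / l%:R).
rewrite !E// !invf_div [X in _ <= X + _]mulrC [X in _ <= _ + X]mulrC; apply.
- exact: exprn_ge0.
- exact: exprn_ge0.
- exact: divr_gt0.
- exact: divr_gt0.
- by rewrite -mulrDl -natrD jld divff// gt_eqF.
Qed.

Lemma powR_natX (v : R) (m d : nat) : 0 <= v -> (v `^ d%:R^-1) ^+ m = v `^ (m%:R / d%:R).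
Proof. by move=> v0; rewrite -powR_mulrn ?powR_ge0// -powRrM mulrC. Qed.

(** The dual Minkowski inequality, an instance of Hoelder's inequality: with
    rho_i = 1 / N_i, the mixed integral of rho_1^j rho_2^l is at most the corresponding
    geometric mean of the integrals of rho_i^d, which are d V_i.  Young's inequality is
    applied pointwise to the radial functions normalized to unit volume. *)
Lemma dual_mixed_volume_le (n : nat) (mu : {measure set 'rV[R]_n -> \bar R}) (j l d : nat)
    (N1 N2 : 'rV[R]_n -> R) :
    (forall t A, 0 < t -> measurable A ->
      mu A = ((t ^+ d)%:E * mu ((fun x => t *: x) @^-1` A))%E) ->
    (mu (unit_ball R n) < +oo)%E ->
    (0 < j)%N -> (0 < l)%N -> (j + l = d)%N -> gauge N1 -> gauge N2 ->
    let V1 := mu [set x | N1 x <= 1] in let V2 := mu [set x | N2 x <= 1] in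
    (0 < V1 < +oo)%E -> (0 < V2 < +oo)%E ->
  (\int[surface d mu]_(x in sphere R n) ((N1 x)^-1 ^+ j * (N2 x)^-1 ^+ l)%:E <=
  (d%:R * (fine V1 `^ (j%:R / d%:R) * fine V2 `^ (l%:R / d%:R)))%:E)%E.
Proof.
move=> mus mub j0 l0 jld g1 g2 V1 V2 V10 V20.
have d0 : (0 < d)%N by rewrite -jld addn_gt0 j0.
have d0' : 0 < d%:R :> R by rewrite ltr0n.
have v10 : 0 < fine V1 by rewrite fine_gt0.
have v20 : 0 < fine V2 by rewrite fine_gt0.
have V1fin : V1 \is a fin_num by case/andP: V10 => /ltW ? ?; rewrite ge0_fin_numE.
have V2fin : V2 \is a fin_num by case/andP: V20 => /ltW ? ?; rewrite ge0_fin_numE.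
(* dividing rho_1 by a and rho_2 by b normalizes the volumes to 1 *)
pose a := fine V1 `^ d%:R^-1; pose b := fine V2 `^ d%:R^-1.
have a0 : 0 < a by exact: powR_gt0.
have b0 : 0 < b by exact: powR_gt0.
have ad : a ^+ d = fine V1 by rewrite powR_natX ?ltW// divff ?gt_eqF// powRr1// ltW.
have bd : b ^+ d = fine V2 by rewrite powR_natX ?ltW// divff ?gt_eqF// powRr1// ltW.
have mS := @measurable_sphere R n.
pose c := a ^+ j * b ^+ l.
have c0 : 0 <= c by rewrite mulr_ge0// exprn_ge0// ltW.
pose c1 := c * (j%:R / d%:R) / fine V1; pose c2 := c * (l%:R / d%:R) / fine V2.
have c10 : 0 <= c1 by rewrite /c1 mulr_ge0 ?invr_ge0 ?(ltW v10)// mulr_ge0// divr_ge0.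
have c20 : 0 <= c2 by rewrite /c2 mulr_ge0 ?invr_ge0 ?(ltW v20)// mulr_ge0// divr_ge0.
have I1 : (\int[surface d mu]_(x in sphere R n) ((N1 x)^-1 ^+ d)%:E = (d%:R * fine V1)%:E)%E.
  have := @gauge_surface_integral R n d mu d0 mus mub N1 setT g1 measurableT (fun _ _ _ _ => I).
  by rewrite !setIT => ->; rewrite EFinM fineK.
have I2 : (\int[surface d mu]_(x in sphere R n) ((N2 x)^-1 ^+ d)%:E = (d%:R * fine V2)%:E)%E.
  have := @gauge_surface_integral R n d mu d0 mus mub N2 setT g2 measurableT (fun _ _ _ _ => I).
  by rewrite !setIT => ->; rewrite EFinM fineK.
have mX (N : 'rV[R]_n -> R) m : gauge N ->
    measurable_fun (sphere R n) (fun x => ((N x)^-1 ^+ m)%:E).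
  by move=> gN; apply/measurable_EFinP/measurable_funTS; exact: measurable_gauge_invX.
have X0 (N : 'rV[R]_n -> R) m x : gauge N -> 0 <= (N x)^-1 ^+ m.
  by move=> gN; rewrite exprn_ge0// invr_ge0 gauge_ge0.
apply: (@le_trans _ _ (\int[surface d mu]_(x in sphere R n)
   (c1%:E * ((N1 x)^-1 ^+ d)%:E + c2%:E * ((N2 x)^-1 ^+ d)%:E))%E).
  apply: ge0_le_integral => //.
  - by move=> x _; rewrite lee_fin mulr_ge0// X0.
  - apply/measurable_EFinP/measurable_funTS; apply: measurable_funM; exact: measurable_gauge_invX.
  - by apply: emeasurable_funD; apply: measurable_funeM; exact: mX.
  - move=> x _; rewrite -!EFinM -EFinD lee_fin.
    have := @young_nat j l d ((N1 x)^-1 / a) ((N2 x)^-1 / b) j0 l0 jld.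
    rewrite !divr_ge0 ?invr_ge0 ?gauge_ge0 ?(ltW a0) ?(ltW b0)// => /(_ isT isT).
    rewrite !expr_div_n ad bd => /(ler_wpM2l c0); rewrite mulrDr.
    rewrite (_ : c * (_ * _) = (N1 x)^-1 ^+ j * (N2 x)^-1 ^+ l); last first.
      rewrite /c mulrACA [a ^+ j * _]mulrC [b ^+ l * _]mulrC !divfK//.
      + by rewrite expf_neq0// gt_eqF.
      + by rewrite expf_neq0// gt_eqF.
    move=> /le_trans; apply; rewrite /c1 /c2.
    by rewrite le_eqVlt; apply/orP; left; apply/eqP; congr (_ + _);
      rewrite !mulrA [RHS]mulrAC.
rewrite ge0_integralD//; last 4 first.
- by move=> x _; rewrite mule_ge0// lee_fin// X0.
- by apply: measurable_funeM; exact: mX.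
- by move=> x _; rewrite mule_ge0// lee_fin// X0.
- by apply: measurable_funeM; exact: mX.
rewrite !ge0_integralZl//; last 4 first.
- exact: mX.
- by move=> x _; rewrite lee_fin// X0.
- exact: mX.
- by move=> x _; rewrite lee_fin// X0.
rewrite I1 I2 -!EFinM -EFinD lee_fin.
rewrite -(powR_natX j d (ltW v10)) -(powR_natX l d (ltW v20)) -/a -/b -/c.
rewrite le_eqVlt; apply/orP; left; apply/eqP.
have d0n : d%:R != 0 :> R by rewrite gt_eqF.
have v1n : fine V1 != 0 by rewrite gt_eqF.
have v2n : fine V2 != 0 by rewrite gt_eqF.
have -> : c1 * (d%:R * fine V1) = c * j%:R by rewrite /c1; field; rewrite d0n v1n.
have -> : c2 * (d%:R * fine V2) = c * l%:R by rewrite /c2; field; rewrite d0n v2n.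
by rewrite -mulrDr -natrD jld mulrC.
Qed.

End dual_mixed_volume.

(** * Orthonormal frames of subspaces *)

Section frames.
Variables (R : realType) (n : nat).

Definition rows_span d (B : 'M[R]_(d, n)) : {vspace 'rV[R]_n} :=
  <<[seq row i B | i : 'I_d]>>%VS.

Lemma rows_spanP d (B : 'M[R]_(d, n)) (x : 'rV[R]_n) :
  reflect (exists c : 'rV[R]_d, x = c *m B) (x \in rows_span B).
Proof.
apply: (iffP idP) => [xB|[c ->]]; last first.
  rewrite mulmx_sum_row; apply: memv_suml => i _; apply: memvZ.
  by apply: memv_span; apply: map_f; rewrite mem_enum.
pose X := [tuple row i B | i < d].
have {}xB : x \in <<X>>%VS by [].
exists (\row_i coord X i x); rewrite mulmx_sum_row [LHS](coord_span xB).
apply: eq_bigr => i _; rewrite mxE; congr (_ *: _).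
by rewrite (nth_map i) ?size_enum_ord// nth_ord_enum.
Qed.

Lemma dim_rows_span_le d (B : 'M[R]_(d, n)) : (\dim (rows_span B) <= d)%N.
Proof.
by apply: leq_trans (dim_span _) _; rewrite size_map size_enum_ord.
Qed.

(** Gram-Schmidt: as long as there are fewer than dim U rows, some u in U lies outside their
    span, and the normalized component of u orthogonal to the rows is added to them. *)
Lemma orthonormal_rows (U : {vspace 'rV[R]_n}) d : (d <= \dim U)%N ->
  exists2 B : 'M[R]_(d, n), B *m B^T = 1%:M & (rows_span B <= U)%VS.
Proof.
elim: d => [_|d IH dU].
  exists 0; first by apply/matrixP => -[].
  by apply/subvP => x /rows_spanP[c ->]; rewrite mulmx0 mem0v.
have [B BB BU] := IH (ltnW dU).
have /subvPn[u uU uB] : ~~ (U <= rows_span B)%VS.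
  by apply/negP => /dimvS UB; move: dU; rewrite ltnNge (leq_trans UB)// dim_rows_span_le.
pose w := u - u *m B^T *m B.
have wB : w *m B^T = 0 by rewrite mulmxBl -(mulmxA _ B) BB mulmx1 subrr.
have wU : w \in U.
  rewrite rpredB//; apply: (subvP BU); apply/rows_spanP; by exists (u *m B^T).
have w0 : enorm w != 0.
  rewrite enorm_eq0 subr_eq0; apply: contraNneq uB => uE.
  by apply/rows_spanP; exists (u *m B^T).
pose v := (enorm w)^-1 *: w.
have vB : v *m B^T = 0 by rewrite -scalemxAl wB scaler0.
have vv : v *m v^T = 1%:M.
  apply/matrixP => i j; rewrite !ord1 -enormE enormZ ger0_norm ?invr_ge0 ?enorm_ge0//.
  by rewrite mulVf// expr1n mxE eqxx.
pose C : 'M[R]_(1 + d, n) := col_mx v B.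
have CC : C *m C^T = 1%:M.
  rewrite /C tr_col_mx mul_col_row vv vB BB.
  have -> : B *m v^T = 0 by rewrite -[LHS]trmxK trmx_mul trmxK vB trmx0.
  by rewrite -scalar_mx_block.
exists C; first exact: CC.
apply/subvP => x /rows_spanP[c ->].
have -> : c *m C = lsubmx (c : 'M[R]_(1, 1 + d)) *m v + rsubmx (c : 'M[R]_(1, 1 + d)) *m B.
  by rewrite -mul_row_col hsubmxK.
apply: memvD; last first.
  by apply: (subvP BU); apply/rows_spanP; exists (rsubmx (c : 'M[R]_(1, 1 + d))).
by rewrite [lsubmx _]mx11_scalar mul_scalar_mx !memvZ.
Qed.

Variable k : nat.
Implicit Types (H : grassmannian R n k) (B : 'M[R]_(n - k, n)).

Lemma exists_frame H : exists B, stiefel B /\ row_span B = val H.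
Proof.
have [B BB BH] := @orthonormal_rows (val H) (n - k) (eq_leq (esym (eqP (valP H)))).
exists B; split => //; apply/eqP; rewrite eqEdim; apply/andP; split => //.
by rewrite (dim_row_span BB) (eqP (valP H)).
Qed.

Lemma frameP H : stiefel (frame H) /\ row_span (frame H) = val H.
Proof. exact: (@xgetPex _ 0 [set B | stiefel B /\ row_span B = val H] (exists_frame H)). Qed.

Lemma stiefel_frame H : frame H *m (frame H)^T = 1%:M.
Proof. exact: (frameP H).1. Qed.

Lemma carrierE H (x : 'rV[R]_n) :
  carrier H x <-> x *m ((frame H)^T *m frame H) = x.
Proof.
have [SB BH] := frameP H; rewrite /carrier/= -BH; split => [/rows_spanP[c ->]|<-].
  by rewrite mulmxA -(mulmxA c) stiefel_frame mulmx1.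
by apply/rows_spanP; exists (x *m (frame H)^T); rewrite mulmxA.
Qed.

Lemma frame_carrier H y : carrier H (y *m frame H).
Proof. by apply/carrierE; rewrite mulmxA -(mulmxA y) stiefel_frame mulmx1. Qed.

Lemma measurable_carrier H : measurable (carrier H).
Proof.
have -> : carrier H = (fun x => x *m (1%:M - (frame H)^T *m frame H)) @^-1` [set 0].
  apply/seteqP; split => x.
    by move=> /carrierE xH; rewrite /= mulmxBr mulmx1 xH subrr.
  by move=> /= /eqP; rewrite mulmxBr mulmx1 subr_eq0 => /eqP xH; apply/carrierE.
rewrite -[X in measurable X]setTI; apply: measurable_fun_mulmx => //.
exact: measurable_origin.
Qed.

Lemma carrierZ H t x : carrier H x -> carrier H (t *: x).
Proof. by move=> xH; rewrite /carrier/= memvZ. Qed.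

(** The change of basis matrix is B' B^T; it is orthogonal because B^T B acts as the identity
    on the common span. *)
Lemma frames_differ_by_orthogonal B B' : stiefel B -> stiefel B' ->
  row_span B = row_span B' -> exists2 O : 'M[R]_(n - k), O *m O^T = 1%:M & B' = O *m B.
Proof.
move=> SB SB' E; exists (B' *m B^T).
  have B'E : B' *m B^T *m B = B'.
    apply/row_matrixP => i.
    have : row i B' \in row_span B' by apply: memv_span; apply: map_f; rewrite mem_enum.
    rewrite -E => /rows_spanP[c ci].
    by rewrite !row_mul ci -(mulmxA c) SB mulmx1.
  by rewrite trmx_mul trmxK mulmxA B'E.
apply/row_matrixP => i.
have : row i B' \in row_span B' by apply: memv_span; apply: map_f; rewrite mem_enum.
rewrite -E => /rows_spanP[c ci].
by rewrite !row_mul ci -(mulmxA c) SB mulmx1.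
Qed.

(** Add to the line through z part of a basis of a complement of this line. *)
Lemma exists_subspace_through (z : 'rV[R]_n) : (k < n)%N -> z != 0 ->
  exists H, carrier H z.
Proof.
move=> kn z0; pose V := (<[z]>^C)%VS.
have dV : \dim V = n.-1 by rewrite dimv_compl dimvf dim_vline z0 /dim/= mul1n subn1.
pose W := <<take (n - k).-1 (vbasis V)>>%VS.
have nk : (0 < n - k)%N by rewrite subn_gt0.
have dW : \dim W = (n - k).-1.
  have fW : free (take (n - k).-1 (vbasis V)).
    have := basis_free (vbasisP V).
    by rewrite -[X in free X](cat_take_drop (n - k).-1); exact: catl_free.
  rewrite (eqP fW) size_takel// size_tuple dV.
  by rewrite -ltnS !prednK ?leq_subr// (leq_ltn_trans _ kn).
have WV : (W <= V)%VS.
  by apply/span_subvP => x /mem_take; exact: vbasis_mem.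
have d : \dim (<[z]> + W)%VS == (n - k)%N.
  rewrite dimv_disjoint_sum; first by rewrite dim_vline z0 dW add1n prednK.
  by apply/eqP; rewrite -subv0 -(capv_compl <[z]>%VS) capvS.
exists (exist _ (<[z]> + W)%VS d); rewrite /carrier/=.
by apply: (subvP (addvSl _ _)); exact: memv_line.
Qed.

Lemma subspace_lebesgueE H A :
  subspace_lebesgue H A = lebesgue_row R (n - k) ((fun y => y *m frame H) @^-1` A).
Proof. by []. Qed.

Lemma subspace_lebesgue_scale H (t : R) A : 0 < t -> measurable A ->
  subspace_lebesgue H A =
  ((t ^+ (n - k))%:E * subspace_lebesgue H ((fun x => t *: x) @^-1` A))%E.
Proof.
move=> t0 mA; rewrite !subspace_lebesgueE (lebesgue_row_scale t0); last first.
  by rewrite -[X in measurable X]setTI; exact: measurable_fun_mulmx.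
congr (_ * lebesgue_row _ _ _)%E; apply/seteqP; split => y /=;
  by rewrite -scalemxAl.
Qed.

Lemma subspace_lebesgue_unit_ball H :
  subspace_lebesgue H (unit_ball R n) = lebesgue_row R (n - k) (unit_ball R (n - k)).
Proof.
rewrite subspace_lebesgueE; congr (lebesgue_row _ _ _).
by apply/seteqP; split => y; rewrite /unit_ball/= enorm_isometry//; exact: stiefel_frame.
Qed.

Lemma subspace_lebesgue_carrier H A :
  subspace_lebesgue H (A `&` carrier H) = subspace_lebesgue H A.
Proof.
rewrite !subspace_lebesgueE; congr (lebesgue_row _ _ _).
apply/seteqP; split => y; first by case.
by move=> Ay; split => //; exact: frame_carrier.
Qed.

End frames.

(** * Compactness of the set of orthonormal frames *)

Section matrix_topology.
Variable R : realType.

Lemma cvg_mx_entries (T : Type) (F : set_system T) (FF : Filter F) m n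
    (f : T -> 'M[R]_(m, n)) (A : 'M[R]_(m, n)) :
  (forall i j, f x i j @[x --> F] --> A i j) -> f x @[x --> F] --> A.
Proof.
move=> fA; apply/cvg_ballP => e e0.
have : \forall x \near F, forall p : 'I_m * 'I_n, ball (A p.1 p.2) e (f x p.1 p.2).
  by apply: filter_forall => p; exact: (cvg_ball (fA p.1 p.2) e0).
by apply: filterS => x fx; split => // i j; exact: (fx (i, j)).
Qed.

Lemma mulmx_continuous m n (y : 'rV[R]_m) : continuous (fun B : 'M[R]_(m, n) => y *m B).
Proof.
move=> B; apply: (@cvg_mx_entries _ (nbhs B) _) => i j; rewrite mxE.
under eq_cvg do rewrite mxE.
have c : continuous (fun B : 'M[R]_(m, n) => \sum_l y i l * B l j).
  apply: continuous_big => [|l _ C]; first exact: add_continuous.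
  apply: (@continuous_comp _ _ _ (fun C : 'M[R]_(m, n) => C l j) (fun z => y i l * z)).
    exact: coord_continuous.
  exact: mulrl_continuous.
exact: c.
Qed.

Lemma mulmxr_continuous m p (B : 'M[R]_(m, p)) : continuous (fun y : 'rV[R]_m => y *m B).
Proof.
move=> y; apply: (@cvg_mx_entries _ (nbhs y) _) => i j; rewrite mxE.
under eq_cvg do rewrite mxE.
have c : continuous (fun y : 'rV[R]_m => \sum_l y i l * B l j).
  apply: continuous_big => [|l _ C]; first exact: add_continuous.
  apply: (@continuous_comp _ _ _ (fun C : 'rV[R]_m => C i l) (fun z => z * B l j)).
    exact: coord_continuous.
  exact: mulrr_continuous.
exact: c.
Qed.

Lemma vec_mx_continuous m n : continuous (@vec_mx R m n).
Proof.
move=> v; apply: (@cvg_mx_entries _ (nbhs v) _) => i j; rewrite mxE.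
under eq_cvg do rewrite mxE.
exact: coord_continuous.
Qed.

Lemma ler_coord_norm n (x : 'rV[R]_n) j : `|x ord0 j| <= `|x|.
Proof.
rewrite [leRHS]/Num.norm/= mx_normrE.
exact: (le_bigmax _ (fun ij : 'I_1 * 'I_n => `|x ij.1 ij.2|) (ord0, j)).
Qed.

Lemma norm_le_coord n (x : 'rV[R]_n) c : 0 <= c -> (forall j, `|x ord0 j| <= c) -> `|x| <= c.
Proof.
move=> c0 xc; rewrite [leLHS]/Num.norm/= mx_normrE.
by apply: bigmax_le => // -[i j] _; rewrite /= ord1.
Qed.

(** The matrices with orthonormal rows are closed, and their entries are bounded by 1;
    compactness is transported from row vectors, where closed bounded sets are compact. *)
Lemma compact_orthonormal_rows m n : compact [set B : 'M[R]_(m, n) | B *m B^T = 1%:M].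
Proof.
set S := [set B | _].
have cS : closed S.
  have -> : S = \bigcap_(p : 'I_m * 'I_m)
      (fun B : 'M[R]_(m, n) => \sum_l B p.1 l * B p.2 l) @^-1` [set (p.1 == p.2)%:R].
    apply/seteqP; split => B.
      move=> BB p _ /=; have /matrixP/(_ p.1 p.2) := BB; rewrite !mxE => <-.
      by apply: eq_bigr => l _; rewrite !mxE.
    move=> H; apply/matrixP => i j; rewrite !mxE -(H (i, j) I).
    by apply: eq_bigr => l _; rewrite !mxE.
  apply: closed_bigI => p _; apply: preimage_closed; last exact: closed_eq.
  have c : continuous (fun B : 'M[R]_(m, n) => \sum_l B p.1 l * B p.2 l).
    apply: continuous_big => [|l _ C]; first exact: add_continuous.
    by apply: (@cvgM _ _ (nbhs C)); exact: coord_continuous.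
  by move=> B _; exact: c.
have -> : S = @vec_mx R m n @` (@vec_mx R m n @^-1` S).
  apply/seteqP; split => [B SB|_ [v Sv <-]//].
  by exists (mxvec B); rewrite /= mxvecK.
apply: continuous_compact; first by apply: continuous_subspaceT; exact: vec_mx_continuous.
apply: bounded_closed_compact; last first.
  by apply: preimage_closed => // v _; exact: vec_mx_continuous.
exists 1; split => // M M1 v Sv; apply: norm_le_coord; first exact: le_trans ler01 (ltW M1).
case/mxvec_indexP => i j; apply: (fun h => le_trans h (ltW M1)).
rewrite -[v]vec_mxK mxvecE.
have -> : (vec_mx v) i j = row i (vec_mx v) ord0 j by rewrite [RHS]mxE.
apply: le_trans (ler_coord_enorm _ _) _.
rewrite -(ler_pXn2r (n := 2))// ?nnegrE ?enorm_ge0// enormE expr1n.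
have /matrixP/(_ i i) : vec_mx v *m (vec_mx v)^T = 1%:M by exact: Sv.
rewrite !mxE eqxx mulr1n => <-; rewrite le_eqVlt; apply/orP; left; apply/eqP.
by apply: eq_bigr => l _; rewrite !mxE.
Qed.

(** Convergence theorems for integrals speak of sequences.  A failure of continuity at B would
    produce points of S at distance below 1/(i+1) from B with values e away from f B. *)
Lemma sequential_continuous_within m n (S : set 'M[R]_(m, n)) (f : 'M[R]_(m, n) -> R) :
    (forall (u : nat -> 'M[R]_(m, n)) B, (forall i, S (u i)) -> S B -> u @ \oo --> B ->
       f (u i) @[i --> \oo] --> f B) ->
  {within S, continuous f}.
Proof.
move=> cf; apply/subspace_continuousP => B SB.
apply/cvgrPdist_lt => e e0; apply: contrapT => H.
have /choice[u uP] : forall i : nat, exists C, [/\ S C, ball B i.+1%:R^-1 C & e <= `|f B - f C|].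
  move=> i; apply: contrapT => nC; apply: H.
  suff : nbhs B (fun C => S C -> `|f B - f C| < e) by [].
  apply/nbhs_ballP; exists i.+1%:R^-1 => /=; first by rewrite invr_gt0.
  move=> C BC SC; rewrite ltNge; apply/negP => eC; apply: nC; by exists C.
have uB : u @ \oo --> B.
  apply/cvg_ballP => r r0; near=> i; have [_ + _] := uP i; apply: le_ball.
  by apply: ltW; near: i; exact: (near_infty_natSinv_lt (PosNum r0)).
have := cf u B (fun i => let: And3 a _ _ := uP i in a) SB uB.
move/cvgrPdist_lt => /(_ e e0)[N _ /(_ N (leqnn N))]/=.
by have [_ _] := uP N; rewrite leNgt => /negP.
Unshelve. all: by end_near. Qed.

End matrix_topology.

(** * Continuity of section volumes and the maximal gap *)

Section section_volume.
Variables (R : realType) (n : nat).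
Implicit Types (K L : set 'rV[R]_n) (N : 'rV[R]_n -> R).

(** The volume of the section of K by the span of the rows of B, when these rows are
    orthonormal. *)
Definition section_vol d K (B : 'M[R]_(d, n)) : R :=
  vol ((fun y : 'rV[R]_d => y *m B) @^-1` K).

Lemma gauge_section d (B : 'M[R]_(d, n)) N : B *m B^T = 1%:M -> gauge N ->
  gauge (fun y : 'rV[R]_d => N (y *m B)).
Proof.
move=> BB [mN Nh Np]; split.
- exact: measurableT_comp mN (@measurable_fun_mulmx R d n B).
- by move=> t y t0; rewrite -scalemxAl Nh.
- move=> y y0; apply: Np; rewrite -enorm_eq0 enorm_isometry// enorm_eq0//.
Qed.

(** The sets {N < 1} and {N <= 1} have the same measure, by homogeneity. *)
Lemma gauge_sphere_null d (N : 'rV[R]_d -> R) : (0 < d)%N -> gauge N ->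
  (lebesgue_row R d [set x | (N x <= 1)%R] < +oo)%E ->
  lebesgue_row R d [set x | N x = 1] = 0%E.
Proof.
move=> d0 gN Noo; have [mN Nh Np] := gN.
have mle := measurable_sublevel gN.
have mlt : measurable [set x | N x < 1].
  have := mN measurableT _ (measurable_itv `]-oo, 1%R[).
  by rewrite setTI; congr measurable; apply/seteqP; split => x /=; rewrite in_itv.
have E : lebesgue_row R d [set x | N x < 1] = lebesgue_row R d [set x | N x <= 1].
  apply: (homogeneous_interior_measure d0 (@lebesgue_row_scale R d)) => //.
    by move=> x /ltW.
  move=> t x /andP[t0 t1] /= Nx; rewrite Nh//.
  by apply: le_lt_trans t1; rewrite -[leRHS]mulr1 ler_wpM2l// ltW.
have -> : [set x | N x = 1] = [set x | N x <= 1] `\` [set x | N x < 1].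
  apply/seteqP; split => x /=; first by move=> ->; rewrite lexx ltxx.
  by move=> [Nx /negP]; rewrite -leNgt => Nx'; apply/eqP; rewrite eq_le Nx.
rewrite measureD//; rewrite (setIidr _); last by move=> x /ltW.
by rewrite [X in (_ - X)%E]E subee// ge0_fin_numE.
Qed.

Lemma star_body_enorm_bounded K : star_body K ->
  exists2 C : R, 0 <= C & forall x, K x -> enorm x <= C.
Proof.
move=> [_ [M [Mr bK]] _ _ _].
pose m := `|M| + 1.
have Mm : M < m by rewrite (le_lt_trans (ler_norm M)) ?ltrDl.
exists (Num.sqrt (\sum_(i < n) m ^+ 2)); first exact: sqrtr_ge0.
move=> x Kx; rewrite ler_wsqrtr//; apply: ler_sum => i _.
rewrite -[leLHS]real_normK ?num_real// ler_pXn2r// ?nnegrE// ?addr_ge0//.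
exact: le_trans (ler_coord_norm x i) (bK m Mm x Kx).
Qed.

Lemma star_body_measurable K : star_body K -> measurable K.
Proof. by move=> [cK _ _ _ _]; exact: closed_row_measurable. Qed.

Lemma measurable_section d K (B : 'M[R]_(d, n)) : star_body K ->
  measurable ((fun y : 'rV[R]_d => y *m B) @^-1` K).
Proof.
move=> sK; rewrite -[X in measurable X]setTI; apply: measurable_fun_mulmx => //.
exact: star_body_measurable.
Qed.

Lemma section_volume_finite d K (B : 'M[R]_(d, n)) : star_body K -> B *m B^T = 1%:M ->
  (lebesgue_row R d ((fun y : 'rV[R]_d => y *m B) @^-1` K) < +oo)%E.
Proof.
move=> sK BB; have [C C0 KC] := star_body_enorm_bounded sK.
apply: (lebesgue_row_bounded C0); first exact: measurable_section.
move=> y Ky i; apply: le_trans (ler_coord_enorm _ _) _.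
by rewrite -(enorm_isometry y BB); exact: KC.
Qed.

(** Dominated convergence: at every y with N (y B) <> 1 the indicators of the sections
    converge, since N is continuous; the exceptional y form a null set, and all sections
    lie in one cube. *)
Lemma section_volume_cvg d K (u : nat -> 'M[R]_(d, n)) (B : 'M[R]_(d, n)) :
    (0 < d)%N -> star_body K -> (forall i, u i *m (u i)^T = 1%:M) -> B *m B^T = 1%:M ->
    u @ \oo --> B -> section_vol K (u i) @[i --> \oo] --> section_vol K B.
Proof.
move=> d0 sK uu BB uB; have [C C0 KC] := star_body_enorm_bounded sK.
pose S (A : 'M[R]_(d, n)) := (fun y : 'rV[R]_d => y *m A) @^-1` K.
have mS A : measurable (S A) by exact: measurable_section.
pose N := Defs.minkowski K.
have gN := star_body_gauge sK.
have cN : continuous N by case: sK.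
have KE := star_bodyE sK.
have SE A : S A = [set y | N (y *m A) <= 1] by rewrite /S [in LHS]KE.
have null : lebesgue_row R d [set y | N (y *m B) = 1] = 0%E.
  apply: (gauge_sphere_null d0 (gauge_section BB gN)).
  by rewrite -SE; exact: section_volume_finite.
have mnull : measurable [set y : 'rV[R]_d | N (y *m B) = 1].
  have [mNB _ _] := gauge_section BB gN.
  by have := mNB measurableT _ (measurable_set1 (1 : R)); rewrite setTI.
have Ncvg (y : 'rV[R]_d) : N (y *m u i) @[i --> \oo] --> N (y *m B).
  apply: (@cvg_comp _ _ _ u (fun A => N (y *m A)) _ _ _ uB).
  apply: (@continuous_comp _ _ _ (fun A : 'M[R]_(d, n) => y *m A) N); last exact: cN.
  exact: mulmx_continuous.
have key : {ae lebesgue_row R d, forall y, setT y ->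
    (\1_(S (u i)) y : R)%:E @[i --> \oo] --> (\1_(S B) y : R)%:E}.
  exists [set y | N (y *m B) = 1]; split => // y /= H; apply: contrapT => N1.
  apply: H => _; have [Nlt|Ngt] := ltP (N (y *m B)) 1.
    have SB : y \in S B by apply/mem_set; rewrite SE /= ltW.
    suff h : \forall i \near \oo, (\1_(S (u i)) y)%:E = (\1_(S B) y)%:E :> \bar R.
      exact: cvg_near_cst.
    have /cvgr_lt/(_ _ Nlt) := Ncvg y; apply: filterS => i Ni.
    by rewrite !indicE SB mem_set// SE/= ltW.
  have {}Ngt : 1 < N (y *m B) by rewrite lt_neqAle Ngt andbT; apply/eqP => e; exact: N1.
  have SB : y \in S B = false by apply/memNset; rewrite SE /= leNgt Ngt.
  suff h : \forall i \near \oo, (\1_(S (u i)) y)%:E = (\1_(S B) y)%:E :> \bar R.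
    exact: cvg_near_cst.
  have /cvgr_gt/(_ _ Ngt) := Ncvg y; apply: filterS => i Ni.
  by rewrite !indicE SB memNset// SE/= leNgt Ni.
have [] := @dominated_convergence _ _ R (lebesgue_row R d) setT measurableT
  (fun i y => (\1_(S (u i)) y)%:E) (fun y => (\1_(S B) y)%:E) (fun y => (\1_(cube R d C) y)%:E).
- by move=> i; exact/measurable_EFinP/measurable_indic.
- exact/measurable_EFinP/measurable_indic.
- exact: key.
- have mC := @measurable_cube R d C.
  apply/integrableP; split; first exact/measurable_EFinP/measurable_indic.
  rewrite (eq_integral (fun y => (\1_(cube R d C) y)%:E)) => [|y _].
    by rewrite integral_indic// setIT lebesgue_row_cube// ltry.
  by rewrite gee0_abs ?lee_fin.
- apply: aeW => y i _; rewrite gee0_abs ?lee_fin//.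
  rewrite !indicE; have [yS|] := boolP (y \in S (u i)); last by rewrite ler0n.
  rewrite mem_set// => l; apply: le_trans (ler_coord_enorm _ _) _.
  by rewrite -(enorm_isometry y (uu i)); apply: KC; exact: set_mem yS.
move=> _ _; rewrite integral_indic// setIT.
rewrite (_ : (fun i => _) = (fun i => lebesgue_row R d (S (u i)))); last first.
  by apply/funext => i; rewrite integral_indic// setIT.
rewrite -[X in _ --> X -> _]fineK; last by rewrite ge0_fin_numE//; exact: section_volume_finite.
by move=> /fine_cvg.
Qed.

Lemma section_vol_orthogonal d K (O : 'M[R]_d) (B : 'M[R]_(d, n)) : star_body K ->
  O *m O^T = 1%:M -> section_vol K (O *m B) = section_vol K B.
Proof.
move=> sK OO; rewrite /section_vol /vol.
rewrite -(lebesgue_row_orthogonal OO (measurable_section B sK)).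
by congr (fine (lebesgue_row _ _ _)); apply/seteqP; split => y /=; rewrite mulmxA.
Qed.

Lemma subspace_volE k (H : grassmannian R n k) K :
  subspace_vol H (K `&` carrier H) = section_vol K (frame H).
Proof. by rewrite /subspace_vol subspace_lebesgue_carrier. Qed.

(** The section volume is continuous on the compact set of orthonormal frames.  It depends on
    the span only, by rotation invariance, so that the frame where the gap is maximal may be
    replaced by the one chosen for its span. *)
Lemma section_gap_max k K L : (k < n)%N -> star_body K -> star_body L ->
  let gaps := [set subspace_vol F (K `&` carrier F) - subspace_vol F (L `&` carrier F) |
                 F in [set: grassmannian R n k]] in
  exists2 M : R, gaps M & ubound gaps M.
Proof.
move=> kn sK sL gaps.
have d0 : (0 < n - k)%N by rewrite subn_gt0.
pose S := [set B : 'M[R]_(n - k, n) | B *m B^T = 1%:M].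
pose g (B : 'M[R]_(n - k, n)) := section_vol K B - section_vol L B.
have [B SB gB] : exists2 B, B \in S & forall t, t \in S -> g t <= g B.
  apply: compact_EVT_max.
  - by exists (frame point); exact: stiefel_frame.
  - exact: compact_orthonormal_rows.
  - apply: sequential_continuous_within => u B uS SB uB.
    by apply: cvgB; exact: section_volume_cvg.
have {}SB : stiefel B by exact: set_mem SB.
pose H : grassmannian R n k := exist _ (row_span B) (introT eqP (dim_row_span SB)).
have [sH fH] := frameP H.
have [Q QQ fE] := frames_differ_by_orthogonal SB sH (esym fH).
exists (g B).
  by exists H => //; rewrite !subspace_volE fE !section_vol_orthogonal.
move=> _ [F _ <-]; rewrite !subspace_volE; apply: gB; apply/mem_set.
exact: stiefel_frame.
Qed.

End section_volume.

(** * Radon transforms of radial functions *)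

Section radon_of_star_bodies.
Variables (R : realType) (n k : nat).
Hypothesis kn : (k < n)%N.
Implicit Types (K L D : set 'rV[R]_n) (H : grassmannian R n k) (N : 'rV[R]_n -> R).

Let d0 : (0 < n - k)%N. Proof. by rewrite subn_gt0. Qed.

(** The integral of a non-negative function is a supremum over the simple functions below it,
    so the comparison holds for every f, measurable or not.  It will be applied to a Radon
    transform, as a function on the Grassmannian. *)
Lemma integral_le_bound d (T : measurableType d) (mu : {measure set T -> \bar R})
    (f : T -> R) (c : R) : (forall x, 0 <= f x <= c) ->
  (\int[mu]_x (f x)%:E <= c%:E * mu setT)%E.
Proof.
move=> fc; rewrite -integral_cst//.
have f0 x : (0 <= (f x)%:E)%E by rewrite lee_fin; case/andP: (fc x).
have c0 x : (0 <= cst c%:E (x : T))%E.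
  by rewrite /cst lee_fin; case/andP: (fc x); exact: le_trans.
rewrite !ge0_integralTE//; apply: le_ereal_sup => _ [h hf <-]; exists h => // x.
apply: le_trans (hf x) _; rewrite /cst lee_fin; by case/andP: (fc x).
Qed.

Lemma ge0_finite_integrable d (T : measurableType d) (mu : {measure set T -> \bar R})
    (A : set T) (f : T -> R) : measurable A -> measurable_fun A f -> (forall x, 0 <= f x) ->
  (\int[mu]_(x in A) (f x)%:E < +oo)%E -> mu.-integrable A (EFin \o f).
Proof.
move=> mA mf f0 foo; apply/integrableP; split; first exact/measurable_EFinP.
by under eq_integral do rewrite gee0_abs ?lee_fin//.
Qed.

Lemma section_integral N H : gauge N ->
  (\int[surface (n - k) (subspace_lebesgue H)]_(x in sphere R n `&` carrier H)
    ((N x)^-1 ^+ (n - k))%:E =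
  (n - k)%:R%:E * subspace_lebesgue H [set x | (N x <= 1)%R])%E.
Proof.
move=> gN; rewrite (@gauge_surface_integral R n (n - k)%N _ d0)//.
- by rewrite subspace_lebesgue_carrier.
- by move=> t A t0 mA; exact: subspace_lebesgue_scale.
- by rewrite subspace_lebesgue_unit_ball; case/andP: (lebesgue_row_unit_ball R (n - k)).
- exact: measurable_carrier.
- by move=> t x t0; exact: carrierZ.
Qed.

Lemma subspace_lebesgue_finite H K : star_body K -> (subspace_lebesgue H K < +oo)%E.
Proof.
by move=> sK; rewrite subspace_lebesgueE; apply: section_volume_finite => //; exact: stiefel_frame.
Qed.

Lemma section_power_integrable H K : star_body K ->
  (surface (n - k) (subspace_lebesgue H)).-integrable (sphere R n `&` carrier H)
    (EFin \o (fun x => radial K x ^+ (n - k))).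
Proof.
move=> sK; have gK := star_body_gauge sK.
apply: ge0_finite_integrable.
- by apply: measurableI; [exact: measurable_sphere|exact: measurable_carrier].
- by apply: measurable_funTS; exact: measurable_gauge_invX.
- by move=> x; rewrite exprn_ge0// invr_ge0 gauge_ge0.
- rewrite section_integral// -star_bodyE//.
  have fin : subspace_lebesgue H K \is a fin_num.
    by rewrite ge0_fin_numE//; exact: subspace_lebesgue_finite.
  by rewrite -(fineK fin) -EFinM ltry.
Qed.

Lemma radon_power H K : star_body K ->
  radon (fun x => radial K x ^+ (n - k)) H = (n - k)%:R * subspace_vol H (K `&` carrier H).
Proof.
move=> sK; rewrite /radon /Rintegral section_integral; last exact: star_body_gauge.
rewrite -star_bodyE// /subspace_vol subspace_lebesgue_carrier fineM//.
by rewrite ge0_fin_numE//; exact: subspace_lebesgue_finite.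
Qed.

(** This turns a bound on the gaps of sections into a bound on a Radon transform. *)
Lemma radon_power_gap H K L : star_body K -> star_body L ->
  radon (fun x => radial K x ^+ (n - k) - radial L x ^+ (n - k)) H =
  (n - k)%:R * (subspace_vol H (K `&` carrier H) - subspace_vol H (L `&` carrier H)).
Proof.
move=> sK sL; rewrite mulrBr -!radon_power// /radon RintegralB//.
- by apply: measurableI; [exact: measurable_sphere|exact: measurable_carrier].
- exact: section_power_integrable.
- exact: section_power_integrable.
Qed.

Lemma radon_cst1 H : radon (fun=> 1) H = (n - k)%:R * omega R (n - k).
Proof.
rewrite /radon /Rintegral.
rewrite (eq_integral (fun x => ((enorm x)^-1 ^+ (n - k))%:E)); last first.
  by move=> x /set_mem[]; rewrite /sphere/= => -> _; rewrite invr1 expr1n.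
rewrite section_integral; last exact: enorm_gauge.
rewrite fineM//; last first.
  have := subspace_lebesgue_unit_ball H; rewrite /unit_ball => ->.
  by rewrite ge0_fin_numE//; case/andP: (lebesgue_row_unit_ball R (n - k)).
by congr (_ * fine _); exact: subspace_lebesgue_unit_ball.
Qed.

Lemma radial_continuous K x : star_body K -> x != 0 -> {for x, continuous (radial K)}.
Proof.
move=> sK x0; apply: (@continuous_comp _ _ _ (Defs.minkowski K) (@GRing.inv R)).
  by case: sK => _ _ _ _; exact.
by apply: inv_continuous; rewrite gt_eqF// star_body_minkowski_gt0.
Qed.

Lemma sphere_neq0 (x : 'rV[R]_n) : sphere R n x -> x != 0.
Proof. by rewrite /sphere/= => x1; rewrite -enorm_gt0 x1. Qed.

Lemma radial_power_continuous K m : star_body K ->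
  {within sphere R n, continuous (fun x => radial K x ^+ m)}.
Proof.
move=> sK; apply: continuous_in_subspaceT => x /set_mem/sphere_neq0 x0.
apply: (@continuous_comp _ _ _ (radial K) (fun t => t ^+ m)).
  exact: radial_continuous.
exact: exprn_continuous.
Qed.

Lemma star_body_volume K : star_body K -> (0 < lebesgue_row R n K < +oo)%E.
Proof.
move=> sK; have [_ _ _ K0 _] := sK; have mK := star_body_measurable sK.
have [C C0 KC] := star_body_enorm_bounded sK.
rewrite (lebesgue_row_nbhs mK K0) (lebesgue_row_bounded C0)//.
by move=> x Kx i; apply: le_trans (ler_coord_enorm _ _) _; exact: KC.
Qed.

Lemma vol_gt0 K : star_body K -> 0 < vol K.
Proof. by move=> sK; rewrite fine_gt0// star_body_volume. Qed.

Lemma vol_fin_num K : star_body K -> lebesgue_row R n K \is a fin_num.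
Proof. by move=> /star_body_volume/andP[_ ?]; rewrite ge0_fin_numE. Qed.

Lemma omega_gt0 m : 0 < omega R m.
Proof. by rewrite fine_gt0// lebesgue_row_unit_ball. Qed.

Lemma radial_ge0 K x : star_body K -> 0 <= radial K x.
Proof. by move=> sK; rewrite invr_ge0 gauge_ge0//; exact: star_body_gauge. Qed.

Lemma radial_le K L x : star_body K -> star_body L -> L `<=` K -> x != 0 ->
  radial L x <= radial K x.
Proof.
move=> sK sL LK x0; rewrite lef_pV2 ?posrE ?star_body_minkowski_gt0//.
exact: minkowski_le.
Qed.

End radon_of_star_bodies.

(** * The bound for one generalized intersection body *)

Section intersection_body_bound.
Variables (R : realType) (n k : nat).
Hypotheses (k0 : (0 < k)%N) (kn : (k < n)%N).
Variables (K L D : set 'rV[R]_n) (M : R).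
Hypotheses (sK : star_body K) (sL : star_body L) (LK : L `<=` K) (KD : K `<=` D).
Hypothesis bD : generalized_intersection_body k D.
Hypothesis gapM : forall F : grassmannian R n k,
  subspace_vol F (K `&` carrier F) - subspace_vol F (L `&` carrier F) <= M.

Let sD : star_body D. Proof. by case: bD. Qed.
Let d0 : (0 < n - k)%N. Proof. by rewrite subn_gt0. Qed.
Let kd : (k + (n - k))%N = n. Proof. by rewrite subnKC// ltnW. Qed.
Let n0 : (0 < n)%N. Proof. exact: leq_ltn_trans kn. Qed.
Let lebS := @lebesgue_row_scale R n.
Let lebB : (lebesgue_row R n (unit_ball R n) < +oo)%E.
Proof. by case/andP: (lebesgue_row_unit_ball R n). Qed.
Let volN (C : set 'rV[R]_n) : star_body C ->
  (0 < lebesgue_row R n [set x | (Defs.minkowski C x <= 1)%R] < +oo)%E.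
Proof. by move=> sC; rewrite -star_bodyE//; exact: star_body_volume. Qed.
Let mrad (C : set 'rV[R]_n) m : star_body C ->
  measurable_fun setT (fun x => radial C x ^+ m : measurableTypeR R).
Proof. by move=> sC; apply: measurable_gauge_invX; exact: star_body_gauge. Qed.
Let rad0 (C : set 'rV[R]_n) m x : star_body C -> 0 <= radial C x ^+ m.
Proof. by move=> sC; rewrite exprn_ge0// radial_ge0. Qed.

Lemma radial_power_le (A B : set 'rV[R]_n) m x : star_body A -> star_body B ->
  A `<=` B -> x != 0 -> radial A x ^+ m <= radial B x ^+ m.
Proof.
move=> sA sB AB x0; apply: lerXn2r; rewrite ?nnegrE ?radial_ge0//.
exact: radial_le.
Qed.

Lemma dual_minkowski (A B : set 'rV[R]_n) : star_body A -> star_body B ->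
  (\int[surface n (lebesgue_row R n)]_(x in sphere R n)
     (radial A x ^+ k * radial B x ^+ (n - k))%:E <=
  (n%:R * (vol A `^ (k%:R / n%:R) * vol B `^ ((n - k)%:R / n%:R)))%:E)%E.
Proof.
move=> sA sB.
have := dual_mixed_volume_le lebS lebB k0 d0 kd
  (star_body_gauge sA) (star_body_gauge sB) (volN sA) (volN sB).
by rewrite -!star_bodyE.
Qed.

Lemma radial_power_volume (A : set 'rV[R]_n) : star_body A ->
  (\int[surface n (lebesgue_row R n)]_(x in sphere R n) (radial A x ^+ n)%:E = (n%:R * vol A)%:E)%E.
Proof.
move=> sA.
have := gauge_surface_integral n0 lebS lebB (star_body_gauge sA) measurableT (fun _ _ _ _ => I).
by rewrite !setIT -star_bodyE// EFinM fineK//; exact: vol_fin_num.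
Qed.

(** The dual Minkowski inequality for D and the unit ball, whose radial function is 1. *)
Lemma radial_power_sphere :
  (\int[surface n (lebesgue_row R n)]_(x in sphere R n) (radial D x ^+ k)%:E <=
  (n%:R * (vol D `^ (k%:R / n%:R) * omega R n `^ ((n - k)%:R / n%:R)))%:E)%E.
Proof.
have := dual_mixed_volume_le lebS lebB k0 d0 kd
  (star_body_gauge sD) (@enorm_gauge R n) (volN sD) (lebesgue_row_unit_ball R n).
rewrite -!star_bodyE//; apply: le_trans; rewrite le_eqVlt; apply/orP; left; apply/eqP.
by apply: eq_integral => x /set_mem; rewrite /sphere/= => ->; rewrite invr1 expr1n mulr1.
Qed.

Lemma gap_bound_ge0 : 0 <= M.
Proof.
apply: le_trans (gapM point); rewrite subr_ge0.
rewrite /subspace_vol !subspace_lebesgue_carrier.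
rewrite fine_le ?ge0_fin_numE ?subspace_lebesgue_finite//.
by apply: le_measure; rewrite ?inE//; exact: star_body_measurable.
Qed.

(** The core of the proof.  The measure mu of D is tested on two functions: the constant 1,
    which bounds the mass of mu by the volume of D (H1), and rho_K^(n-k) - rho_L^(n-k),
    whose Radon transform is at most (n-k) M (H2).  Since rho_D >= rho_K on the sphere, the
    spherical integral for the second function dominates n |K| minus a dual mixed volume of
    K and L (H3). *)
Lemma intersection_body_gap_bound :
  vol K `^ (k%:R / n%:R) * (vol K `^ ((n - k)%:R / n%:R) - vol L `^ ((n - k)%:R / n%:R)) <=
  M * (vol D `^ (k%:R / n%:R) * (omega R n `^ ((n - k)%:R / n%:R) / omega R (n - k))).
Proof.
have [_ _ [mu muE]] := bD.
pose sigma := surface n (lebesgue_row R n).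
have mS := @measurable_sphere R n.
pose m := fine (mu setT).
have m0 : 0 <= m by rewrite fine_ge0.
have mufin : mu setT \is a fin_num by exact: fin_num_measure.
have muK : mu setT = m%:E by rewrite fineK.
have d0' : 0 < (n - k)%:R :> R by rewrite ltr0n.
have n0' : 0 < n%:R :> R by rewrite ltr0n.
have od0 := omega_gt0 R (n - k).
have H1 : (n - k)%:R * omega R (n - k) * m <=
    n%:R * (vol D `^ (k%:R / n%:R) * omega R n `^ ((n - k)%:R / n%:R)).
  have c1 : {within sphere R n, continuous (fun=> 1 : R)}.
    by apply: continuous_subspaceT => x; exact: cst_continuous.
  have := muE (fun=> 1) c1.
  rewrite [X in _ = X -> _](_ : _ = (n - k)%:R * omega R (n - k) * m); last first.
    rewrite /Rintegral; under eq_integral do rewrite radon_cst1//.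
    by rewrite integral_cst// fineM// muK.
  move=> <-; rewrite -lee_fin /Rintegral.
  under eq_integral do rewrite mulr1.
  have h := radial_power_sphere.
  rewrite fineK// ge0_fin_numE ?(le_lt_trans h) ?ltry//.
  by apply: integral_ge0 => x _; rewrite lee_fin rad0.
pose g x := radial K x ^+ (n - k) - radial L x ^+ (n - k).
have cg : {within sphere R n, continuous g}.
  by move=> x; apply: cvgB; exact: radial_power_continuous.
have g0 x : sphere R n x -> 0 <= g x.
  by move=> /sphere_neq0 x0; rewrite subr_ge0 radial_power_le.
have mg : measurable_fun setT (g : _ -> measurableTypeR R).
  by apply: measurable_funB; exact: mrad.
pose A := (\int[sigma]_(x in sphere R n) (radial D x ^+ k * g x)%:E)%E.
have A0 : (0 <= A)%E.
  by apply: integral_ge0 => x Sx; rewrite lee_fin mulr_ge0 ?rad0 ?g0.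
have Afin : A \is a fin_num.
  rewrite ge0_fin_numE//; apply: le_lt_trans (le_lt_trans (dual_minkowski sD sK) (ltry _)).
  apply: ge0_le_integral => //.
  - by move=> x Sx; rewrite lee_fin mulr_ge0 ?rad0 ?g0.
  - by apply/measurable_EFinP/measurable_funTS; apply: measurable_funM => //; exact: mrad.
  - by apply/measurable_EFinP/measurable_funTS; apply: measurable_funM; exact: mrad.
  - by move=> x Sx; rewrite lee_fin ler_wpM2l ?rad0// lerBlDr lerDl rad0.
have H2 : fine A <= (n - k)%:R * M * m.
  have := muE g cg; rewrite [X in X = _](_ : _ = fine A)// => ->.
  rewrite /Rintegral -[leRHS]/(fine ((n - k)%:R * M * m)%:E).
  have h : (\int[mu]_H (radon g H)%:E <= ((n - k)%:R * M * m)%:E)%E.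
    rewrite EFinM -muK; apply: integral_le_bound => H; rewrite radon_power_gap//.
    apply/andP; split; last by rewrite ler_wpM2l ?gapM// ltW.
    apply: mulr_ge0; first exact: ltW.
    rewrite subr_ge0.
    rewrite /subspace_vol !subspace_lebesgue_carrier.
    rewrite fine_le ?ge0_fin_numE ?subspace_lebesgue_finite//.
    by apply: le_measure; rewrite ?inE//; exact: star_body_measurable.
  have h0 : (0 <= \int[mu]_H (radon g H)%:E)%E.
    apply: integral_ge0 => H _; rewrite lee_fin; apply: Rintegral_ge0 => x [Sx _].
    exact: g0.
  by apply: fine_le => //; rewrite ge0_fin_numE// (le_lt_trans h) ?ltry.
have H3 : n%:R * vol K <= fine A +
    n%:R * (vol K `^ (k%:R / n%:R) * vol L `^ ((n - k)%:R / n%:R)).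
  rewrite -lee_fin EFinD fineK// -radial_power_volume//.
  apply: le_trans (leeD2l _ (dual_minkowski sK sL)).
  rewrite /A -ge0_integralD//; last 4 first.
  - by move=> x Sx; rewrite lee_fin mulr_ge0 ?rad0 ?g0.
  - by apply/measurable_EFinP/measurable_funTS; apply: measurable_funM => //; exact: mrad.
  - by move=> x Sx; rewrite lee_fin mulr_ge0 ?rad0.
  - by apply/measurable_EFinP/measurable_funTS; apply: measurable_funM => //; exact: mrad.
  apply: ge0_le_integral => //.
  - by move=> x _; rewrite lee_fin rad0.
  - by apply/measurable_EFinP/measurable_funTS; exact: mrad.
  - apply/measurable_EFinP/measurable_funTS; apply: measurable_funD.
      by apply: measurable_funM => //; exact: mrad.
    by apply: measurable_funM; exact: mrad.
  - move=> x /[dup] Sx /sphere_neq0 x0; rewrite -EFinD lee_fin.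
    have -> : radial K x ^+ n = radial K x ^+ k * radial K x ^+ (n - k).
      by rewrite -exprD kd.
    rewrite -lerBlDr -mulrBr.
    by rewrite ler_wpM2r ?g0// radial_power_le.
have vK := vol_gt0 sK.
have Kpow : vol K `^ (k%:R / n%:R) * vol K `^ ((n - k)%:R / n%:R) = vol K.
  rewrite -powRD; last by rewrite (gt_eqF vK) implybT.
  by rewrite -mulrDl -natrD kd divff ?gt_eqF// powRr1// ltW.
rewrite mulrBr Kpow.
set a := vol K `^ _ * _; set b := vol D `^ _; set w := omega R n `^ _.
have H4 : n%:R * (vol K - a) <= (n - k)%:R * M * m.
  by rewrite mulrBr lerBlDr; apply: le_trans H3 _; rewrite lerD2r.
have M0 := gap_bound_ge0.
have H5 : (n - k)%:R * M * m <= M * (n%:R * (b * w) / omega R (n - k)).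
  rewrite mulrAC [leLHS]mulrC ler_wpM2l// ler_pdivlMr//.
  by rewrite mulrAC.
rewrite -(ler_pM2l n0'); apply: le_trans H4 (le_trans H5 _).
by rewrite le_eqVlt; apply/orP; left; apply/eqP; rewrite [RHS]mulrCA !mulrA.
Qed.

End intersection_body_bound.

(** * Distinct bodies have a positive gap *)

Section strict_gap.
Variables (R : realType) (n k : nat).
Hypothesis kn : (k < n)%N.

(** Some point x of K lies outside L, and a point z = t x with t slightly less than 1 is
    interior to K and still outside L.  A neighbourhood of z lies in K minus L, and a
    subspace through z meets it in a set of positive volume. *)
Lemma strict_section_gap (K L : set 'rV[R]_n) :
    star_body K -> star_body L -> L `<=` K -> K <> L ->
  exists F : grassmannian R n k,
    0 < subspace_vol F (K `&` carrier F) - subspace_vol F (L `&` carrier F).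
Proof.
move=> sK sL LK KL.
have gK := star_body_gauge sK; have gL := star_body_gauge sL.
have [x Kx Lx] : exists2 x, K x & ~ L x.
  apply: contrapT => H; apply: KL; apply/seteqP; split => // x Kx.
  by apply: contrapT => Lx; apply: H; exists x.
pose NK := Defs.minkowski K; pose NL := Defs.minkowski L.
have NKx : NK x <= 1 by move: Kx; rewrite {1}(star_bodyE sK).
have NLx : 1 < NL x by rewrite ltNge; apply/negP => h; apply: Lx; rewrite (star_bodyE sL).
have NL0 : 0 < NL x by apply: lt_trans NLx.
(* t must satisfy 1 / NL x < t < 1 *)
pose t := ((NL x)^-1 + 1) / 2.
have i1 : (NL x)^-1 < 1 by rewrite invf_lt1.
have t0 : 0 < t by rewrite divr_gt0// addr_gt0// invr_gt0.
have t1 : t < 1 by rewrite ltr_pdivrMr// mul1r ltrD2r.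
have t2 : (NL x)^-1 < t by rewrite ltr_pdivlMr// mulr_natr mulr2n ltrD2l.
have [_ hK _] := gK; have [_ hL _] := gL.
pose z := t *: x.
have NKz : NK z < 1.
  rewrite /NK hK//; apply: le_lt_trans t1; rewrite -[leRHS]mulr1.
  by rewrite ler_wpM2l// ltW.
have NLz : 1 < NL z by rewrite /NL hL// -ltr_pdivrMr// mul1r.
have z0 : z != 0.
  by apply: contraTneq NLz => ->; rewrite /NL (gauge0 gL) ltr10.
have [F Fz] := exists_subspace_through kn z0; exists F.
pose B := frame F; pose y0 := z *m B^T.
have y0B : y0 *m B = z by rewrite -mulmxA; exact/carrierE.
pose V := [set y : 'rV[R]_(n - k) | NK (y *m B) < 1] `&` [set y | 1 < NL (y *m B)].
have cK : continuous (fun y : 'rV[R]_(n - k) => NK (y *m B)).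
  move=> y; apply: (@continuous_comp _ _ _ (fun y : 'rV[R]_(n - k) => y *m B) NK).
    exact: mulmxr_continuous.
  by case: sK => _ _ _ _; exact.
have cL : continuous (fun y : 'rV[R]_(n - k) => NL (y *m B)).
  move=> y; apply: (@continuous_comp _ _ _ (fun y : 'rV[R]_(n - k) => y *m B) NL).
    exact: mulmxr_continuous.
  by case: sL => _ _ _ _; exact.
have oV : open V.
  apply: openI.
    by move/continuousP : cK => /(_ [set t | t < 1]); apply; exact: open_lt.
  by move/continuousP : cL => /(_ [set t | 1 < t]); apply; exact: open_gt.
have mV := open_row_measurable oV.
have V0 : (0 < lebesgue_row R (n - k) V)%E.
  apply: (lebesgue_row_nbhs (x := y0) mV); apply: open_nbhs_nbhs; split => //.
  by split => /=; rewrite y0B.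
have BB : B *m B^T = 1%:M := stiefel_frame F.
have mS (C : set 'rV[R]_n) : star_body C -> measurable ((fun y => y *m B) @^-1` C).
  exact: measurable_section.
rewrite !subspace_volE subr_gt0 /section_vol /vol.
have Kfin := section_volume_finite sK BB; have Lfin := section_volume_finite sL BB.
rewrite fine_lt ?ge0_fin_numE//.
set SL := (fun y => y *m B) @^-1` L in Lfin *.
set SK := (fun y => y *m B) @^-1` K in Kfin *.
have LVK : SL `|` V `<=` SK.
  move=> y [Ly|[Ky _]]; first exact: LK.
  by rewrite /SK /= (star_bodyE sK) /= ltW.
have LV0 : SL `&` V = set0.
  rewrite -subset0 => y [Ly [_ /= Vy]].
  by move: Ly; rewrite /SL/= {1}(star_bodyE sL)/= leNgt Vy.
apply: (@lt_le_trans _ _ (lebesgue_row R (n - k) (SL `|` V))).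
  by rewrite measureU//; [rewrite lteDl ?ge0_fin_numE|exact: mS].
by apply: le_measure; rewrite ?inE//; [apply: measurableU => //; exact: mS|exact: mS].
Qed.

End strict_gap.

(** * The inequality for the outer volume ratio distance *)

Lemma c_constX (R : realType) n k : (0 < k)%N ->
  c_const R n k ^+ k = omega R n `^ ((n - k)%:R / n%:R) / omega R (n - k).
Proof.
move=> k0; have w0 : 0 <= omega R n `^ ((n - k)%:R / n%:R) / omega R (n - k).
  by rewrite divr_ge0 ?powR_ge0// ltW// omega_gt0.
by rewrite /c_const powR_natX// divff ?powRr1// pnatr_eq0 -lt0n.
Qed.

Lemma expe_pinfty (R : realType) k : (0 < k)%N -> ((+oo : \bar R) ^+ k = +oo)%E.
Proof.
by elim: k => // -[|k] IH _; [rewrite expeS mule1|rewrite expeS IH// mulyy].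
Qed.

Theorem theorem1p2 (R : realType) (n k : nat) (hk : (1 <= k)%N) (hkn : (k < n)%N)
    (K L : set 'rV[R]_n)
    (starK : star_body K) (symK : origin_symmetric K)
    (starL : star_body L) (symL : origin_symmetric L) (LK : L `<=` K) :
  let gaps := [set subspace_vol F (K `&` carrier F) - subspace_vol F (L `&` carrier F) |
                 F in [set: grassmannian R n k]] in
  exists M : R, [/\ gaps M, ubound gaps M &
    ((vol K `^ ((n - k)%:R / n%:R) - vol L `^ ((n - k)%:R / n%:R))%:E
     <= (c_const R n k ^+ k)%:E * ovr_distance k K ^+ k * M%:E)%E].
Proof.
move=> gaps; have [M gM uM] := section_gap_max hkn starK starL.
exists M; split => //.
have gapM (F : grassmannian R n k) :
    subspace_vol F (K `&` carrier F) - subspace_vol F (L `&` carrier F) <= M.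
  by apply: uM; exists F.
have M0 : 0 <= M := gap_bound_ge0 starK starL LK gapM.
set C := c_const R n k ^+ k.
have C0 : 0 < C.
  by rewrite /C c_constX// divr_gt0 ?powR_gt0 ?omega_gt0.
have ovr0 : (0 <= ovr_distance k K)%E.
  by apply: le_ereal_inf_tmp => _ [D _ <-]; rewrite lee_fin powR_ge0.
(* If K = L the left-hand side is 0.  Otherwise M > 0, so that the right-hand side is
   infinite when no generalized intersection body contains K. *)
have [KL|KL] := pselect (K = L).
  rewrite -KL subrr; apply: mule_ge0; last by rewrite lee_fin.
  by apply: mule_ge0; [rewrite lee_fin ltW|exact: expe_ge0].
have {}M0 : 0 < M.
  by have [F F0] := strict_section_gap hkn starK starL LK KL; exact: lt_le_trans F0 (gapM F).
set a := _ - _.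
have vK := vol_gt0 starK.
have bound D : K `<=` D -> generalized_intersection_body k D ->
    a <= C * ((vol D / vol K) `^ n%:R^-1) ^+ k * M.
  move=> KD bD; have := intersection_body_gap_bound hk hkn starK starL LK KD bD gapM.
  rewrite -/a -c_constX// -/C.
  have vD : 0 < vol D by apply: vol_gt0; case: bD.
  rewrite powR_natX; last by rewrite divr_ge0// ltW.
  set r := k%:R / n%:R.
  have q0 : 0 < vol K `^ r by exact: powR_gt0.
  have -> : (vol D / vol K) `^ r = vol D `^ r / vol K `^ r.
    rewrite powRM ?invr_ge0 ?(ltW vD) ?(ltW vK)//; congr (_ * _).
    by rewrite -powR_inv1 ?(ltW vK)// -powRrM mulN1r powRN.
  rewrite mulrC -ler_pdivlMr// => /le_trans; apply.
  by rewrite le_eqVlt; apply/orP; left; apply/eqP; ring.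
have a0 : 0 <= a.
  rewrite subr_ge0 ge0_ler_powR ?nnegrE ?divr_ge0 ?(ltW (vol_gt0 starL)) ?(ltW vK)//.
  rewrite fine_le ?vol_fin_num//.
  by apply: le_measure; rewrite ?inE//; exact: star_body_measurable.
have CM0 : 0 < C * M by rewrite mulr_gt0.
(* t is the lower bound that a puts on every (|D| / |K|)^(1/n) *)
pose t := (a / (C * M)) `^ k%:R^-1.
have tk : t ^+ k = a / (C * M).
  by rewrite powR_natX ?divr_ge0 ?(ltW CM0)// divff ?powRr1 ?divr_ge0 ?(ltW CM0)// pnatr_eq0 -lt0n.
have t0 : 0 <= t by exact: powR_ge0.
have tinf : (t%:E <= ovr_distance k K)%E.
  apply: le_ereal_inf_tmp => _ [D [KD bD] <-]; rewrite lee_fin.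
  rewrite -(ler_pXn2r hk) ?nnegrE ?powR_ge0// tk ler_pdivrMr//.
  by rewrite mulrA [_ * C]mulrC; exact: bound.
case: (ovr_distance k K) tinf ovr0 => [r| |].
- rewrite !lee_fin => tr r0; rewrite -EFin_expe -!EFinM lee_fin.
  have : t ^+ k <= r ^+ k by rewrite lerXn2r.
  by rewrite tk ler_pdivrMr// mulrA [_ * C]mulrC.
- by move=> _ _; rewrite expe_pinfty// gt0_muley ?lte_fin// gt0_mulye ?lte_fin// leey.
- by move=> _; rewrite leeNy_eq.
Qed.
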